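(* Let $t\ge 3$ be an integer and let $G$ be any one of the following $t$-chromatic graphs: (a) a Kneser graph $KG(n,k)$ with $k\ge 1$, $n\ge 2k$ and $n-2k+2=t$; (b) a Schrijver graph $SG(n,k)$ with $k\ge 1$, $n\ge 2k$ and $n-2k+2=t$; (c) a generalized Mycielski graph $M_{r_{t-2}}(\cdots M_{r_2}(M_{r_1}(K_2))\cdots)$ with integers $r_1,\dots,r_{t-2}\ge 1$; (d) a Borsuk graph $B(t-1,\alpha)$ with $0<\alpha<2$ and chromatic number $t$. Then $\psi(G)\ge\lfloor t/2\rfloor+2$. In particular, if $t=2r$ is even then $\psi(G)\ge r+2$, and if $t=4$ then $\psi(G)=4$.
   Context: The local chromatic number of a (possibly infinite) graph $G$ is $\psi(G):=\min_c\max_{v\in V(G)}|\{c(u):u\in N(v)\}|+1$, where $c$ ranges over all proper colorings of $G$ (with any number of colors) and $N(v)$ is the set of neighbors of $v$. The Kneser graph $KG(n,k)$ has as vertices the $k$-element subsets of $\{1,\dots,n\}$, two being adjacent iff they are disjoint. The Schrijver graph $SG(n,k)$ is the induced subgraph of $KG(n,k)$ on those $k$-subsets that contain no two cyclically consecutive elements (no pair $\{i,i+1\}$, $1\le i<n$, and not the pair $\{1,n\}$). For a graph $G$ and an integer $r\ge1$ the generalized Mycielskian $M_r(G)$ has vertex set $\{(i,v):0\le i\le r-1,\ v\in V(G)\}\cup\{z\}$; $(i,v)$ and $(j,w)$ are adjacent iff $vw\in E(G)$ and either $|i-j|=1$ or $i=j=0$; $z$ is adjacent exactly to the vertices $(r-1,v)$,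 $v\in V(G)$. The Borsuk graph $B(n,\alpha)$, $0<\alpha<2$, is the infinite graph whose vertices are the points of the unit sphere $\mathbb S^{n-1}\subset\mathbb R^n$ and whose edges connect the pairs of points at Euclidean distance at least $\alpha$. *)

(* Defs.v *)
From mathcomp Require Import all_boot all_order all_algebra.
From mathcomp Require Import boolp classical_sets functions cardinality reals.

Set Implicit Arguments.
Unset Strict Implicit.
Unset Printing Implicit Defensive.

Import Order.TTheory GRing.Theory Num.Theory.

Local Open Scope classical_set_scope.

(* Simple graphs on an arbitrary, possibly infinite, vertex type. *)
Record graph := Graph {
  vertex :> Type;
  adj : vertex -> vertex -> Prop;
  adj_sym : forall u v, adj u v -> adj v u;
  adj_irr : forall v, ~ adj v v }.

Definition neighbors (G : graph) (v : G) : set G := [set u | adj v u].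

Definition proper_coloring (G : graph) (C : Type) (c : G -> C) : Prop :=
  forall u v : G, adj u v -> c u <> c v.

(* The least element of P, and 0 if P is empty. *)
Definition min_nat (P : set nat) : nat :=
  xget 0 [set m | P m /\ forall n, P n -> m <= n].

(* Equal to 0 for graphs that have no proper coloring with finitely many
   colors. *)
Definition chromatic_number (G : graph) : nat :=
  min_nat [set m | exists c : G -> 'I_m, proper_coloring c].

(* m is the maximum over the vertices v of |{c(u) : u \in N(v)}|. There is no
   such m when these cardinalities are unbounded or infinite. *)
Definition max_neighbor_colors (G : graph) (C : Type) (c : G -> C) (m : nat) :
    Prop :=
  (forall v : G, (c @` neighbors v #<= `I_m)%card) /\
  (exists v : G, (c @` neighbors v #= `I_m)%card).

(* The colors range over all types. Colorings for which the maximum is infinite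
   do not affect the minimum, unless all of them are such; the value is then 0
   instead of infinity, so that a positive lower bound on it also says that the
   minimum is finite and attained. *)
Definition local_chromatic_number (G : graph) : nat :=
  min_nat [set p | exists (C : Type) (c : G -> C) (m : nat),
    [/\ proper_coloring c, max_neighbor_colors c m & p = m + 1]].

Section InducedSubgraph.
Variables (G : graph) (P : pred G).

Definition induced_adj (u v : {x : G | P x}) : Prop := adj (val u) (val v).

Fact induced_sym u v : induced_adj u v -> induced_adj v u.
Proof. exact: adj_sym. Qed.

Fact induced_irr v : ~ induced_adj v v.
Proof. exact: adj_irr. Qed.

Definition induced : graph := Graph induced_sym induced_irr.
End InducedSubgraph.

Section Complete.
Variable n : nat.

Definition complete_adj (i j : 'I_n) : Prop := i <> j.

Fact complete_sym i j : complete_adj i j -> complete_adj j i.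
Proof. by move=> ij ji; apply: ij. Qed.

Fact complete_irr i : ~ complete_adj i i.
Proof. by apply. Qed.

Definition complete_graph : graph := Graph complete_sym complete_irr.
End Complete.

Section Kneser.
Variables n k : nat.

(* The ground set {1, ..., n} is represented by 'I_n = {0, ..., n - 1}. *)
Definition ksubset := {A : {set 'I_n} | #|A| == k}.

(* A <> B only matters for k = 0, when the empty set is disjoint from itself. *)
Definition Kneser_adj (A B : ksubset) : Prop := A <> B /\ [disjoint val A & val B]%B.

Fact Kneser_sym A B : Kneser_adj A B -> Kneser_adj B A.
Proof. by case=> AB dAB; split; [move=> BA; apply: AB | rewrite disjoint_sym]. Qed.

Fact Kneser_irr A : ~ Kneser_adj A A.
Proof. by case. Qed.

Definition Kneser : graph := Graph Kneser_sym Kneser_irr.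

(* In terms of 'I_n, the pair {1, n} is {0, n - 1}. *)
Definition stable (A : {set 'I_n}) : bool :=
  [forall i in A, forall j in A,
     (j != i.+1 :> nat) && ~~ ((i == 0 :> nat) && (j == n - 1 :> nat))].

Definition Schrijver : graph := @induced Kneser (fun A : ksubset => stable (val A)).
End Kneser.

Section Mycielskian.
Variables (r : nat) (G : graph).

(* None is the vertex z. *)
Definition Mycielskian_adj (x y : option ('I_r * G)) : Prop :=
  match x, y with
  | Some (i, v), Some (j, w) =>
      adj v w /\ [\/ j = i.+1 :> nat, i = j.+1 :> nat | i = 0 :> nat /\ j = 0 :> nat]
  | Some (i, _), None | None, Some (i, _) => i = r - 1 :> nat
  | None, None => False
  end.

Fact Mycielskian_sym x y : Mycielskian_adj x y -> Mycielskian_adj y x.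
Proof.
case: x y => [[i v]|] [[j w]|] //= [vw ij]; split; first exact: adj_sym.
by case: ij => [||[]]; [constructor 2 | constructor 1 | constructor 3].
Qed.

Fact Mycielskian_irr x : ~ Mycielskian_adj x x.
Proof. by case: x => [[i v]|] //= [/adj_irr]. Qed.

Definition Mycielskian : graph := Graph Mycielskian_sym Mycielskian_irr.
End Mycielskian.

(* For rs = [:: r_1; ...; r_m], this is M_{r_m}(... M_{r_1}(K_2) ...). *)
Definition iterated_Mycielskian (rs : seq nat) : graph :=
  foldl (fun G r => Mycielskian r G) (complete_graph 2) rs.

Section Borsuk.
Local Open Scope ring_scope.
Variables (R : realType) (n : nat) (alpha : R).

(* The library norm on 'rV[R]_n is the sup norm, not the Euclidean one. *)
Definition euclidean_norm (x : 'rV[R]_n) : R :=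
  Num.sqrt (\sum_(i < n) x ord0 i ^+ 2).

Definition sphere := {x : 'rV[R]_n | euclidean_norm x == 1}.

(* x <> y is redundant for alpha > 0. *)
Definition Borsuk_adj (x y : sphere) : Prop :=
  x <> y /\ alpha <= euclidean_norm (val x - val y).

Fact Borsuk_sym x y : Borsuk_adj x y -> Borsuk_adj y x.
Proof.
case=> xy dxy; split; first by move=> yx; apply: xy.
congr (_ <= Num.sqrt _): dxy; apply: eq_bigr => i _.
by rewrite -sqrrN !mxE opprB.
Qed.

Fact Borsuk_irr x : ~ Borsuk_adj x x.
Proof. by case. Qed.

Definition Borsuk : graph := Graph Borsuk_sym Borsuk_irr.
End Borsuk.

(* Main.v *)
Require Import Defs.
From mathcomp Require Import all_boot all_order all_algebra.
From mathcomp Require Import boolp classical_sets functions cardinality reals.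
From mathcomp Require Import zify ring lra.

(** Let M be an iterated generalized Mycielskian of K_2 with t - 2 levels.

The proof has two halves.  The first half bounds M from below: in every proper
coloring of M some vertex sees floor(t/2) + 1 colors (many_colors).  The second
half maps some such M, with many rows at each level, into each of the other
graphs.  A coloring of the target pulls back to M, and the neighbors of a vertex
go to neighbors of its image, so the bound passes to the target.

First half.  Consider the complex N(M) of the vertex tuples with a common
neighbor.  Forming M_r(G) suspends this complex: its tuples lie on a cylinder
over N(G), one end of which is coned off by z while the other end is filled by a
full simplex, the row adjacent to z.  Hence N(M) has no reduced homology modulo
2 in dimensions below t - 2 (acyclic_iterated).  The pairs (a, b) of tuples that
span a complete bipartite subgraph form a double complex that is acyclic in the
same range (bicliques_acyclic), and exchanging a and b is a free involution of
it.  Acyclicity yields the cells of an equivariant sphere of dimension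
t - 2, and an argument in the style of Ky Fan shows that an odd number of its
top cells, counted by multiplicity, have colors that alternate between a and b
in increasing order, the least one on a (fan_chain).

An alternating cell has t distinct colors.  For odd t its larger side has
(t + 1)/2 of them, all in the neighborhood of any vertex of the smaller side.
For t = 2r both sides have only r colors, and the product structure of
cohomology is needed.  Suppose that no neighborhood has more than r colors.  For
a set X of r colors, being colored by X is then a cocycle U of degree r - 1 in
a, and alternating with X is a cocycle V of degree r - 1 in b, because a tuple
of r + 1 vertices with a common neighbor repeats a color.  So the indicator of
the alternating cells is a sum of cup products of cocycles of degree r - 1,
which vanish on a sphere of dimension 2r - 2 >= 2.  Concretely, the sides b
opposite to a side a colored by X form a cycle of N(M), this cycle bounds, and V
vanishes on boundaries.  Hence the number of alternating cells is even, a
contradiction.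

Second half.  Placing row i at height i/r with alternating sign maps M to the
unit sphere so that adjacent vertices are almost antipodal
(sphere_hom_exists).  This is a homomorphism to the Borsuk graph.  For
Schrijver graphs, a point x of the sphere gives the values
w_i = (-1)^i p(i) of a polynomial p of degree at most d = n - 2k, and w has
n - d = 2k terms, bounded away from 0, whose signs alternate
(newton_alternates).  The k positive ones are the elements of a stable set,
and almost antipodal points have disjoint sets. *)

Set Implicit Arguments.
Unset Strict Implicit.
Unset Printing Implicit Defensive.

Import Order.TTheory GRing.Theory Num.Theory.

(** * Chains modulo 2 *)

Section Chains.
Variable T : Type.
Implicit Types (f : seq T -> bool) (s : seq T) (c : seq (seq T)).

(** Chains with coefficients in F_2 are lists, and two lists stand for the same
chain when all cochains take the same value on them.  This avoids both a
quotient and a decidable equality on vertices. *)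
Definition ev (A : Type) (f : A -> bool) (c : seq A) : bool :=
  \big[addb/false]_(x <- c) f x.

(** The empty tuple is the only face of a singleton, so the complex is augmented
and all homology below is reduced. *)
Fixpoint faces s : seq (seq T) :=
  if s is x :: s' then s' :: [seq x :: s'' | s'' <- faces s'] else [::].

(** The simplicial coboundary of f. *)
Definition cob f s := ev f (faces s).

(** Reduced homology of the complex K modulo 2 vanishes in dimension q - 1. *)
Definition acyclic (K : pred (seq T)) (q : nat) : Prop :=
  forall c, all K c -> all (fun s => size s == q) c ->
    (forall f, ev (cob f) c = false) ->
  exists d, [/\ all K d, all (fun s => size s == q.+1) d &
    forall f, ev f c = ev (cob f) d].
End Chains.

Section Evaluation.
Variable A : Type.
Implicit Types (f g : A -> bool) (c : seq A).

Lemma ev_nil f : ev f [::] = false. Proof. exact: big_nil. Qed.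
Lemma ev_cons f x c : ev f (x :: c) = f x (+) ev f c. Proof. exact: big_cons. Qed.
Lemma ev_cat f c d : ev f (c ++ d) = ev f c (+) ev f d. Proof. exact: big_cat. Qed.
End Evaluation.

Section EvaluationTheory.
Variable A : Type.
Implicit Types (f g : A -> bool) (c : seq A).

Lemma ev_map B (h : B -> A) f (c : seq B) : ev f (map h c) = ev (f \o h) c.
Proof. exact: big_map. Qed.
Lemma ev_flatten f (cc : seq (seq A)) : ev f (flatten cc) = ev (ev f) cc.
Proof.
elim: cc => [|c cc IH] /=; first by rewrite !ev_nil.
by rewrite ev_cat ev_cons IH.
Qed.
Lemma ev_add f g c : ev (fun x => f x (+) g x) c = ev f c (+) ev g c.
Proof. exact: big_split. Qed.
Lemma eq_ev f g c : f =1 g -> ev f c = ev g c.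
Proof. by move=> fg; apply: eq_bigr. Qed.
Lemma eq_ev_all (P : pred A) f g c :
  all P c -> (forall x, P x -> f x = g x) -> ev f c = ev g c.
Proof.
move=> + fg; elim: c => [|x c IH] /=; first by rewrite !ev_nil.
by case/andP=> /fg fgx /IH fgc; rewrite !ev_cons fgx fgc.
Qed.
Lemma ev0 c : ev (fun=> false) c = false.
Proof. by apply: big1. Qed.
Lemma ev_andl b f c : ev (fun x => b && f x) c = b && ev f c.
Proof. by case: b; rewrite //= ev0. Qed.
Lemma ev_filter (P : pred A) f c : ev f (filter P c) = ev (fun x => P x && f x) c.
Proof.
elim: c => [|x c IH] /=; first by rewrite !ev_nil.
rewrite ev_cons -IH.
by case: (P x); rewrite ?ev_cons.
Qed.
Lemma ev_has (P : pred A) f c : all P c -> ev f c -> exists2 x, P x & f x.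
Proof.
elim: c => [|x c IH] /=; first by rewrite ev_nil.
case/andP=> Px Pc; rewrite ev_cons; case fx: (f x); first by exists x.
exact: IH.
Qed.
Lemma ev_exchange B (f : A -> B -> bool) c (d : seq B) :
  ev (fun x => ev (f x) d) c = ev (fun y => ev (f^~ y) c) d.
Proof. exact: exchange_big. Qed.
End EvaluationTheory.

Lemma all_flatten A (P : pred A) (cc : seq (seq A)) :
  all P (flatten cc) = all (all P) cc.
Proof. by elim: cc => //= c cc IH; rewrite all_cat IH. Qed.

Section ChainTheory.
Variable T : Type.
Implicit Types (f : seq T -> bool) (s : seq T) (c : seq (seq T)).

Lemma cob_nil f : cob f [::] = false. Proof. exact: ev_nil. Qed.

Lemma cob_cons f x s : cob f (x :: s) = f s (+) cob (f \o cons x) s.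
Proof. by rewrite /cob /= ev_cons ev_map. Qed.

Lemma cob_cob f s : cob (cob f) s = false.
Proof.
elim: s f => [|x s IH] f; first exact: cob_nil.
rewrite cob_cons.
have -> : cob (cob f \o cons x) s = cob f s (+) cob (cob (f \o cons x)) s.
  by rewrite /cob -ev_add; apply: eq_ev => s'; rewrite /= ev_cons ev_map.
by rewrite IH addbF addbb.
Qed.

Lemma all_faces (P : pred T) s : all P s -> all (all P) (faces s).
Proof.
elim: s => //= x s IH /andP[Px Ps]; rewrite Ps all_map /=.
by apply: sub_all (IH Ps) => s' /= ->; rewrite Px.
Qed.

Lemma size_faces s : all (fun s' => (size s').+1 == size s) (faces s).
Proof.
elim: s => //= x s IH; rewrite eqxx all_map /=.
by apply: sub_all IH => s' /=; lia.
Qed.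

Lemma faces_map (U : Type) (h : T -> U) s : faces (map h s) = map (map h) (faces s).
Proof. by elim: s => //= x s ->; rewrite -!map_comp. Qed.

Lemma cob_map (U : Type) (h : T -> U) (f : seq U -> bool) s :
  cob f (map h s) = cob (f \o map h) s.
Proof. by rewrite /cob faces_map ev_map. Qed.

Lemma ev_bd f c : ev f (flatten (map (@faces T) c)) = ev (cob f) c.
Proof. by rewrite ev_flatten ev_map. Qed.

Lemma acyclic_cone (K : pred (seq T)) w q :
  (forall s, K s -> K (w :: s)) -> acyclic K q.
Proof.
move=> Kw c Kc cq cyc; exists (map (cons w) c); split.
- by rewrite all_map; apply: sub_all Kc.
- by rewrite all_map; apply: sub_all cq.
- move=> f; rewrite ev_map -[LHS]addbF -(cyc (f \o cons w)) -ev_add.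
  by apply: eq_ev => s; rewrite /= cob_cons.
Qed.

Section Prism.
Variable g : T -> T.

(** The subdivided prism between s and its image under g, which makes contiguous
maps homotopic. *)
Fixpoint prism s : seq (seq T) :=
  if s is x :: s' then (x :: g x :: map g s') :: map (cons x) (prism s') else [::].

Lemma all_prism (P : pred T) s :
  all P s -> all P (map g s) -> all (all P) (prism s).
Proof.
elim: s => //= x s IH /andP[Px Ps] /andP[Pgx Pgs].
rewrite Px Pgx Pgs all_map /=.
by apply: sub_all (IH Ps Pgs) => s' /= ->; rewrite Px.
Qed.

Lemma size_prism s : all (fun s' => size s' == (size s).+1) (prism s).
Proof.
elim: s => //= x s IH; rewrite size_map eqxx all_map /=.
by apply: sub_all IH => s'.
Qed.

Lemma prism_bd f s :
  ev (cob f) (prism s) (+) cob (fun s' => ev f (prism s')) s = f s (+) f (map g s).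
Proof.
elim: s f => [|x s IH] f; first by rewrite /= cob_nil ev_nil !addbb.
rewrite [prism _]/= ev_cons ev_map !cob_cons.
have -> : ev (cob f \o cons x) (prism s)
    = ev f (prism s) (+) ev (cob (f \o cons x)) (prism s).
  by rewrite -ev_add; apply: eq_ev => s'; rewrite /= cob_cons.
have -> : cob ((fun s' => ev f (prism s')) \o cons x) s
    = cob (f \o cons x \o cons (g x)) (map g s)
      (+) cob (fun s' => ev (f \o cons x) (prism s')) s.
  rewrite cob_map /cob -ev_add; apply: eq_ev => s'.
  by rewrite /= ev_cons ev_map.
have := IH (f \o cons x).
rewrite /=.
set a := ev (cob _) _; set b := cob (fun s' => ev (f \o cons x) (prism s')) s.
set u := ev f _; set v := cob _ (map g s).
case: a; case: b; case: u; case: v; case: (f (x :: s)); case: (f (x :: map g s));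
  by case: (f (g x :: map g s)).
Qed.
End Prism.

(** A cycle of K is homologous to its image under g, which lies in K'. *)
Lemma acyclic_homotopy (K K' : pred (seq T)) (g : T -> T) q :
  (forall s, K s -> K' (map g s)) -> (forall s, K s -> all K (prism g s)) ->
  (forall s, K' s -> K s) -> acyclic K' q -> acyclic K q.
Proof.
move=> KK' Kp K'K acy c Kc cq cyc.
have [||f|d [K'd dq cd]] := acy (map (map g) c).
- by rewrite all_map; apply: sub_all Kc => s /KK'.
- by rewrite all_map; apply: sub_all cq => s /=; rewrite size_map.
- by rewrite ev_map -(cyc (f \o map g)); apply: eq_ev => s; rewrite /= cob_map.
exists (d ++ flatten (map (prism g) c)); split.
- rewrite all_cat (sub_all K'K K'd) all_flatten all_map.
  by apply: sub_all Kc => s /Kp.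
- rewrite all_cat dq all_flatten all_map.
  apply: sub_all cq => s /= /eqP <-; exact: size_prism.
- move=> f; rewrite ev_cat -cd ev_flatten !ev_map -ev_add.
  rewrite -[LHS]addbF -(cyc (fun s' => ev f (prism g s'))) -ev_add.
  apply: eq_ev => s /=; have := prism_bd g f s.
  set a := ev _ _; set b := cob _ s.
  by case: a; case: b; case: (f s); case: (f (map g s)).
Qed.

(** The Mayer-Vietoris argument.  A cycle of the union is split into a part c0 in
K0 and a part c1 in K1.  They have the same boundary, which lies in the
intersection and bounds a chain g there; then c0 + g and c1 + g are cycles. *)
Lemma acyclic_union (K0 K1 : pred (seq T)) q :
  (forall s, K0 s -> all K0 (faces s)) -> (forall s, K1 s -> all K1 (faces s)) ->
  acyclic K0 q -> acyclic K1 q ->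
  (forall q', q = q'.+1 -> acyclic (predI K0 K1) q') ->
  acyclic (predU K0 K1) q.
Proof.
move=> F0 F1 acy0 acy1 acyI c Kc cq cyc.
pose c0 := filter K0 c; pose c1 := filter (predC K0) c.
have evc f : ev f c = ev f c0 (+) ev f c1.
  by rewrite !ev_filter -ev_add; apply: eq_ev => s /=; case: (K0 s); rewrite ?addbF.
have K0c0 : all K0 c0 by apply: filter_all.
have K1c1 : all K1 c1.
  rewrite all_filter; apply: sub_all Kc => s /= /orP[->|->] //.
  by apply/implyP.
have c0q : all (fun s => size s == q) c0.
  by rewrite all_filter; apply: sub_all cq => s /= ->; rewrite implybT.
have c1q : all (fun s => size s == q) c1.
  by rewrite all_filter; apply: sub_all cq => s /= ->; rewrite implybT.
have cyc01 f : ev (cob f) c0 = ev (cob f) c1.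
  by have := cyc f; rewrite evc; case: (ev _ c0); case: (ev _ c1).
(* The boundary of c0; faces outside K1 cancel, and filter drops them. *)
pose e := filter K1 (flatten (map (@faces T) c0)).
have eE f : ev f e = ev (cob f) c0.
  rewrite ev_filter ev_bd !cyc01; apply: eq_ev_all K1c1 _ => s /F1 K1s.
  by apply: eq_ev_all K1s _ => s' ->.
have [g [Kg gq eg]] : exists g, [/\ all (predI K0 K1) g,
    all (fun s => size s == q) g & forall f, ev (cob f) c0 = ev (cob f) g].
  case: q acyI c0q {acy0 acy1 cq c1q} => [_ c0q | q /(_ q erefl) acyI c0q].
    exists [::]; split=> // f; rewrite ev_nil -[RHS](ev0 c0).
    by apply: eq_ev_all c0q _ => s /nilP ->; apply: cob_nil.
  have [||f|g [Kg gq eg]] := acyI e.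
  - rewrite all_filter all_flatten all_map.
    apply: sub_all K0c0 => s /F0 /=; apply: sub_all => s' /= ->.
    by apply/implyP.
  - rewrite all_filter all_flatten all_map.
    apply: sub_all c0q => s /= /eqP sq; apply: sub_all (size_faces s) => s' /= h.
    by apply/implyP => _; lia.
  - by rewrite eE -[RHS](ev0 c0); apply: eq_ev => s; apply: cob_cob.
  by exists g; split=> // f; rewrite -eE.
have [Kg0 Kg1] : all K0 g /\ all K1 g by apply/andP; rewrite -all_predI.
have [||f|d0 [Kd0 d0q e0]] := acy0 (c0 ++ g); rewrite ?all_cat ?K0c0 ?c0q //.
  by rewrite ev_cat eg addbb.
have [||f|d1 [Kd1 d1q e1]] := acy1 (c1 ++ g); rewrite ?all_cat ?K1c1 ?c1q //.
  by rewrite ev_cat -cyc01 eg addbb.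
exists (d0 ++ d1); split; rewrite ?all_cat ?d0q //.
- rewrite (sub_all _ Kd0) ?(sub_all _ Kd1) // => s /= ->; rewrite ?orbT //.
- move=> f; rewrite ev_cat -e0 -e1 evc !ev_cat.
  by case: (ev f c0); case: (ev f c1); case: (ev f g).
Qed.
End ChainTheory.

(** * The neighborhood complex of a generalized Mycielskian *)

Definition adjb (G : graph) (u v : G) : bool := `[< adj u v >].

Lemma adjbC (G : graph) (u v : G) : adjb u v = adjb v u.
Proof. by apply/asboolP/asboolP; apply: adj_sym. Qed.

Definition nbhd (G : graph) : pred (seq G) :=
  fun s => `[< exists v, all (adjb v) s >].

Section MycielskianNbhd.
Variables (r' : nat) (G : graph).
Local Notation r := r'.+1.
Let M := Mycielskian r G.
Implicit Types (x : M) (s : seq M) (v w : G) (j p : nat).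

(** The p-th entry of the list r - 1, r - 3, ... of the rows of the parity of r - 1
in decreasing order, followed by the rows of the other parity in increasing
order.  If z is given the position r after them, then the neighbors of each
vertex (i, v) lie at two consecutive positions. *)
Definition lev p : nat := if 2 * p < r then r - 1 - 2 * p else 2 * p - r.

Lemma lev_lt p : p < r -> lev p < r. Proof. rewrite /lev; case: ifP; lia. Qed.

Lemma lev_inj p q : p < r -> q < r -> lev p = lev q -> p = q.
Proof. rewrite /lev; case: ifP; case: ifP; lia. Qed.

Definition at_pos p x : bool :=
  if x is Some (i, _) then (p < r) && (i == lev p :> nat) else p == r.

Definition over v x : bool := if x is Some (_, w) then adjb v w else true.

(** The vertices at two consecutive positions that lie over neighbors of v. *)
Definition strip v p x : bool := (at_pos p x || at_pos p.+1 x) && over v x.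

(** The part of the cylinder over N(G) from position j on, including z. *)
Definition tube j : pred (seq M) :=
  fun s => `[< exists v p, [/\ j <= p, p <= r & all (strip v p) s] >].

Definition top_level : pred (seq M) := all (at_pos 0).

(** The row of the vertices whose neighbors lie at the positions p and p + 1. *)
Definition mid p : nat := if 2 * p + 2 <= r then r - 2 - 2 * p else 2 * p + 1 - r.

Lemma mid_lt p : p < r -> mid p < r. Proof. rewrite /mid; case: ifP; lia. Qed.

Lemma mid_surj (i : 'I_r) : exists2 p, p < r & mid p = i.
Proof.
have lir := ltn_ord i.
have [e|o] : r'.+1 = (i + 2 + 2 * ((r' - 1 - i) %/ 2))%N \/
  (r' + i = 2 * ((r' + i) %/ 2))%N by lia.
- by exists ((r' - 1 - i) %/ 2); [lia | rewrite /mid; case: ifP; lia].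
- by exists ((r' + i) %/ 2); [lia | rewrite /mid; case: ifP; lia].
Qed.

Lemma at_pos_inj x p q : at_pos p x -> at_pos q x -> p = q.
Proof.
case: x => [[i w]|] /=; last by move=> /eqP -> /eqP ->.
by case/andP=> pr /eqP ip /andP[qr /eqP iq]; apply: lev_inj => //; rewrite -ip.
Qed.

Lemma adj_mid p (pr : mid p < r) v x :
  p < r -> adjb (Some (Ordinal pr, v) : M) x = strip v p x.
Proof.
move=> ltpr; case: x => [[i w]|] /=; rewrite /strip /over /=.
- have ir := ltn_ord i.
  apply/asboolP/andP => [[vw h] | [/orP h /asboolP vw]].
    split; last exact/asboolP.
    by case: h; rewrite /lev /mid /= => h; apply/orP; move: h ir pr; rewrite /lev /mid; do !case: ifP; lia.
  split=> //; rewrite /=.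
  move: h; rewrite /lev => h.
  have [|[|]] : i = (Ordinal pr).+1 :> nat \/ (Ordinal pr = i.+1 :> nat \/ (Ordinal pr = 0 :> nat /\ i = 0 :> nat)).
    rewrite /= /mid; move: h ir pr; do !case: ifP; lia.
  + by constructor 1.
  + by constructor 2.
  + by constructor 3.
- rewrite andbT; apply/asboolP/idP => /= h.
  + by move: h pr; rewrite /mid; case: ifP; lia.
  + by move: h pr; rewrite /mid; case: ifP; lia.
Qed.

Lemma nbhd_Mycielskian s : nbhd s = tube 0 s || top_level s.
Proof.
apply/asboolP/orP => [[[[i v]|] vs] | [/asboolP[v [p [_ ple ps]]]|tops]].
- left; apply/asboolP; exists v; have [p pr ip] := mid_surj i.
  exists p; split; [by [] | exact: ltnW |]; apply: sub_all vs => x.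
  have mr : mid p < r by rewrite ip.
  by have -> : i = Ordinal mr; [apply: val_inj | rewrite adj_mid].
- right; apply: sub_all vs => -[[i w]|] /asboolP //= ir.
  by rewrite ir /lev muln0 /= subn0.
- have [pr|rp] := ltnP p r.
    exists (Some (Ordinal (mid_lt pr), v)).
    by apply: sub_all ps => x; rewrite adj_mid.
  have r1 : r.-1 < r by [].
  exists (Some (Ordinal (mid_lt r1), v)).
  apply: sub_all ps => x; rewrite adj_mid // /strip.
  have -> : p = r by apply/eqP; rewrite eqn_leq ple.
  by case: x => [[i w]|] //=; rewrite ?ltnn ?eqxx ?orbT //= ltnNge leqnSn.
- exists None; apply: sub_all tops => -[[i w]|] //= /eqP il.
  by apply/asboolP; rewrite /= il /lev muln0 /= subn0.
Qed.

(** Pushes the vertices at position j one step towards z. *)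
Definition shift j x : M :=
  if at_pos j x then
    if x is Some (i, w) then if j.+1 < r then Some (inord (lev j.+1), w) else None
    else None
  else x.

Lemma shift_strip v j p x : j < r -> j <= p -> strip v p x -> strip v p (shift j x).
Proof.
move=> jr jp; rewrite /shift; case: ifP => //.
case: x => [[i w]|]; last by rewrite /= ltn_eqF.
rewrite /strip => atj /andP[h vw].
have {h} pj : p = j.
  case/orP: h => h; first exact: at_pos_inj h atj.
  by have := at_pos_inj h atj; lia.
case: ltnP => [jr1|rj]; rewrite pj /= ?vw.
  by rewrite inordK ?lev_lt // eqxx jr1 orbT.
by rewrite andbT; apply/orP; right; apply/eqP; lia.
Qed.

Lemma shift_next v j p x : j < r -> j <= p -> strip v p x ->
  strip v (maxn p j.+1) (shift j x).
Proof.
move=> jr jp; have [pj|pj] := eqVneq p j.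
  have -> : maxn p j.+1 = j.+1 by lia.
  subst p; rewrite /shift /strip; case: ifP => atj; last by case/andP=> /= -> ->.
  case: x atj => [[i w]|]; last by rewrite /= ltn_eqF.
  move=> atj /andP[_ vw].
  case: ltnP => [jr1|rj]; rewrite /= ?vw ?andbT.
    by rewrite inordK ?lev_lt // eqxx jr1.
  by apply/orP; left; apply/eqP; lia.
have -> : maxn p j.+1 = p by lia.
exact: shift_strip.
Qed.

(** The cylinder collapses onto z, one position at a time. *)
Lemma acyclic_tube j q : j <= r -> acyclic (tube j) q.
Proof.
move=> jr; have [m mE] : exists m, m = r - j by exists (r - j).
elim: m j jr mE => [|m IH] j jr mE.
  have -> : j = r by lia.
  apply: (acyclic_cone (w := None)) => s /asboolP[v [p [jp pr ps]]].
  apply/asboolP; exists v, p; split=> //=; rewrite ps andbT /strip /=.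
  by rewrite andbT; apply/orP; left; rewrite eqn_leq jp pr.
have ltjr : j < r by lia.
apply: (acyclic_homotopy (K' := tube j.+1) (g := shift j)).
- move=> s /asboolP[v [p [jp pr ps]]]; apply/asboolP; exists v, (maxn p j.+1).
  split; [lia | lia |]; rewrite all_map; apply: sub_all ps => x /=.
  exact: shift_next.
- move=> s /asboolP[v [p [jp pr ps]]].
  suff : all (all (strip v p)) (prism (shift j) s).
    by apply: sub_all => s' ps'; apply/asboolP; exists v, p.
  apply: all_prism => //; rewrite all_map; apply: sub_all ps => x /=.
  exact: shift_strip.
- move=> s /asboolP[v [p [jp pr ps]]]; apply/asboolP; exists v, p; split=> //; lia.
- by apply: IH; lia.
Qed.

Let r0 : lev 0 < r := lev_lt (ltn0Sn r').

Definition lift_top w : M := Some (Ordinal r0, w).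

(** The row adjacent to z is a full simplex, hence a cone. *)
Lemma acyclic_top_level w q : acyclic top_level q.
Proof. by apply: (acyclic_cone (w := lift_top w)) => s /= ->; rewrite eqxx. Qed.

Definition base (w0 : G) x : G := if x is Some (_, w) then w else w0.

(** The cylinder meets the full simplex of its end in a copy of N(G). *)
Lemma acyclic_tube_top w0 q :
  acyclic (@nbhd G) q -> acyclic (predI (tube 0) top_level) q.
Proof.
move=> acy c Kc cq cyc.
have [||f|d [Kd dq cd]] := acy (map (map (base w0)) c).
- rewrite all_map; apply: sub_all Kc => s /andP[/asboolP[v [p [_ _ ps]]] tops].
  apply/asboolP; exists v; rewrite all_map.
  have : all (predI (strip v p) (at_pos 0)) s by rewrite all_predI ps.
  by apply: sub_all => -[[i w]|] /andP[] //= /andP[].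
- by rewrite all_map; apply: sub_all cq => s /=; rewrite size_map.
- by rewrite ev_map -(cyc (f \o map (base w0))); apply: eq_ev => s; rewrite /= cob_map.
exists (map (map lift_top) d); split.
- rewrite all_map; apply: sub_all Kd => s /asboolP[v vs] /=; apply/andP; split.
    apply/asboolP; exists v, 0; split=> //; rewrite all_map.
    by apply: sub_all vs => w vw; rewrite /strip /= eqxx vw.
  by rewrite /top_level all_map; apply: sub_all vs => w _ /=; rewrite eqxx.
- by rewrite all_map; apply: sub_all dq => s /=; rewrite size_map.
- move=> f; rewrite ev_map.
  transitivity (ev (cob (f \o map lift_top)) d); last first.
    by apply: eq_ev => s; rewrite /= cob_map.
  rewrite -cd ev_map; apply: eq_ev_all Kc _ => s /andP[_ tops] /=.
  congr f; elim: s tops => //= x s IH /andP[x0 /IH sE]; congr cons => //.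
  case: x x0 => [[i w]|] //= /eqP i0; congr (Some (_, _)); exact: val_inj.
Qed.

(** Mayer-Vietoris for the cylinder, which z cones off at one end, and the simplex
that fills the other end: the homology of N(G) moves up by one dimension. *)
Lemma acyclic_Mycielskian w0 q :
  (forall q', q' < q -> acyclic (@nbhd G) q') -> acyclic (@nbhd M) q.
Proof.
move=> acy.
have e : @nbhd M = predU (tube 0) top_level.
  by apply/funext => s; rewrite nbhd_Mycielskian.
rewrite e; apply: acyclic_union.
- move=> s /asboolP[v [p [jp pr ps]]]; apply: sub_all (all_faces ps) => s' ps'.
  by apply/asboolP; exists v, p.
- by move=> s; apply: all_faces.
- exact: acyclic_tube.
- exact: acyclic_top_level w0 _.
- move=> q' qq'; apply: (acyclic_tube_top w0); apply: acy; lia.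
Qed.
End MycielskianNbhd.

Lemma acyclic_K2 : acyclic (@nbhd (complete_graph 2)) 0.
Proof.
move=> c _ c0 _; exists (nseq (ev xpredT c) [:: ord0]).
have h : @nbhd (complete_graph 2) [:: ord0].
  by apply/asboolP; exists ord_max; rewrite /= andbT; apply/asboolP.
split; try by case: ev => //=; rewrite h.
move=> f; transitivity (ev xpredT c && f [::]).
  by rewrite andbC -ev_andl; apply: eq_ev_all c0 _ => s /nilP ->; rewrite andbT.
by case: ev => /=; rewrite ?ev_nil // ev_cons ev_nil addbF cob_cons cob_nil addbF.
Qed.

Lemma iterated_rcons rs r :
  iterated_Mycielskian (rcons rs r) = Mycielskian r (iterated_Mycielskian rs).
Proof. by rewrite /iterated_Mycielskian foldl_rcons. Qed.

Lemma iterated_point rs : inhabited (iterated_Mycielskian rs).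
Proof.
elim/last_ind: rs => [|rs r _]; first exact: (inhabits ord0).
rewrite iterated_rcons; exact: (inhabits None).
Qed.

Lemma acyclic_iterated rs q : all (fun r => 1 <= r) rs -> q <= size rs ->
  acyclic (@nbhd (iterated_Mycielskian rs)) q.
Proof.
elim/last_ind: rs q => [|rs r IH] q; first by case: q => // _ _; apply: acyclic_K2.
rewrite all_rcons size_rcons iterated_rcons => /andP[r1 rs1] qs.
case: r r1 => // r _; have [w0] := iterated_point rs.
by apply: (acyclic_Mycielskian w0) => q' q'q; apply: IH => //; lia.
Qed.

(** * The complex of bicliques *)

Section Bicliques.
Variable G : graph.
Local Notation pair := (seq G * seq G)%type.
Implicit Types (p : pair) (f : pair -> bool) (a b : seq G) (c d : seq pair).

(** A cell of dimension m - 2: the product of the simplices p.1 and p.2. *)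
Definition biclique m p : bool :=
  [&& 0 < size p.1, 0 < size p.2, size p.1 + size p.2 == m &
      all (fun u => all (adjb u) p.2) p.1].

Definition pcob f p : bool :=
  cob (fun a => f (a, p.2)) p.1 (+) cob (fun b => f (p.1, b)) p.2.

(** A pair with an empty side is not a cell, so pcob (red f) is the coboundary of f
in the complex of the cells. *)
Definition red f p : bool := [&& 0 < size p.1, 0 < size p.2 & f p].

Definition swap p : pair := (p.2, p.1).

Lemma eq_cob T (f g : seq T -> bool) s : f =1 g -> cob f s = cob g s.
Proof. exact: eq_ev. Qed.

Lemma cob_add T (f g : seq T -> bool) s :
  cob (fun x => f x (+) g x) s = cob f s (+) cob g s.
Proof. exact: ev_add. Qed.

Lemma cob0 T (s : seq T) : cob (fun=> false) s = false.
Proof. exact: ev0. Qed.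

Lemma pcob_pcob f p : pcob (pcob f) p = false.
Proof.
case: p => a b; rewrite /pcob /= !cob_add !cob_cob /= addbF.
rewrite {1}/cob [X in _ (+) X]/cob /cob.
by rewrite ev_exchange addbb.
Qed.

Lemma eq_pcob f g p : f =1 g -> pcob f p = pcob g p.
Proof. by move=> fg; congr addb; apply: eq_cob. Qed.

Lemma red_pcob f p : red (pcob (red f)) p = pcob (red f) p.
Proof.
case: p => a b; rewrite /red /pcob /=.
case: a => [|x a] /=; first by rewrite cob_nil cob0.
case: b => [|y b] //=; rewrite cob_nil addbF /=.
by symmetry; rewrite -[RHS](cob0 (x :: a)); apply: eq_cob => a'; rewrite andbF.
Qed.

Lemma biclique_swap m p : biclique m (swap p) = biclique m p.
Proof.
rewrite /biclique /= addnC andbCA; do 3!congr andb.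
case: p => a b /=; elim: a => [|x a IH] /=; first by elim: b.
rewrite -{}IH; elim: b => //= y b ->.
by rewrite adjbC; do !case: (all _ _); case: (adjb x y).
Qed.

Lemma pcob_swap f p : pcob (f \o swap) p = pcob f (swap p).
Proof. by rewrite /pcob addbC. Qed.

Lemma red_swap f p : red (f \o swap) p = red f (swap p).
Proof. by rewrite /red andbCA. Qed.

Lemma biclique_nbhd m p : biclique m p -> nbhd p.1.
Proof.
case: p => a [|y b] /and4P[//= _ _ _ ab]; apply/asboolP; exists y.
by apply: sub_all ab => x /= /andP[xy _]; rewrite adjbC.
Qed.

Definition pbd p : seq pair :=
  [seq q <- [seq (a, p.2) | a <- faces p.1] ++ [seq (p.1, b) | b <- faces p.2]
  | (0 < size q.1) && (0 < size q.2)].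

Lemma ev_pbd f p : ev f (pbd p) = pcob (red f) p.
Proof.
rewrite /pbd ev_filter ev_cat !ev_map; congr addb;
  by apply: eq_ev => s; rewrite /red /= -andbA.
Qed.

Lemma biclique_pbd m p : biclique m.+1 p -> all (biclique m) (pbd p).
Proof.
case: p => a b /and4P[/= a0 b0 /eqP abm ab].
rewrite /pbd all_filter all_cat !all_map; apply/andP; split.
- have := all_faces ab; have := size_faces a.
  elim: (faces a) => //= a' l IH /andP[/eqP sa /IH h] /andP[ab' /h ->].
  by rewrite andbT; apply/implyP => /andP[a'0 _]; apply/and4P; split=> //=; lia.
- have ba' : all (fun v : G => all (fun u : G => adjb u v) a) b.
    have : biclique m.+1 (swap (a, b)).
      by rewrite biclique_swap; apply/and4P; split=> //=; apply/eqP.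
    case/and4P=> _ _ _ /=; apply: sub_all => v; apply: sub_all => u.
    by rewrite adjbC.
  have := all_faces ba'; have := size_faces b.
  elim: (faces b) => //= b' l IH /andP[/eqP sb /IH h] /andP[ab' /h ->].
  rewrite andbT; apply/implyP => /andP[_ b'0]; apply/and4P; split=> //=; first lia.
  have : biclique (size b' + size a) (b', a).
    apply/and4P; split=> //=; apply: sub_all ab' => v; apply: sub_all => u.
    by rewrite adjbC.
  by rewrite -biclique_swap => /and4P[].
Qed.

Section Acyclicity.
Variables (x0 : G) (m : nat).
Hypothesis m2 : 1 < m.

(** A fixed common neighbor of a, with an arbitrary default value. *)
Definition common a : G :=
  if pselect (exists v, all (adjb v) a) is left h then projT1 (cid h) else x0.

Lemma commonP a : nbhd a -> all (adjb (common a)) a.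
Proof.
move/asboolP => h; rewrite /common; case: pselect => // h'.
by case: (cid h').
Qed.

(** The contraction of the fibre over p.1 onto its point common p.1. *)
Definition extend p : pair := (p.1, common p.1 :: p.2).

Lemma biclique_extend p : biclique m p -> biclique m.+1 (extend p).
Proof.
move=> pm; have := commonP (biclique_nbhd pm); case/and4P: pm => a0 b0 /eqP ab pab pa.
apply/and4P; split=> //=; first by rewrite addnS ab.
have := conj pab pa; rewrite -[_ /\ _]/(is_true _ /\ is_true _) => /andP.
rewrite -all_predI; apply: sub_all => x /andP[h1 h2] /=.
by rewrite adjbC h2.
Qed.

(** The part of c with the smallest second sides, of size j, is a cycle in the fibre
direction, and extend contracts each fibre.  Adding the boundary of the
contraction moves this part to larger second sides, which cannot go on forever.
For j = 1 the fibres contribute their points, and it is assumed that these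
cancel. *)
Lemma bounds_above c j : 0 < j -> all (biclique m) c ->
  (forall f, ev (pcob (red f)) c = false) ->
  all (fun p => j <= size p.2) c ->
  (j = 1 -> forall f : seq G -> bool, ev (fun p => (size p.2 == 1) && f p.1) c = false) ->
  exists d, all (biclique m.+1) d /\ forall f, ev f c = ev (pcob (red f)) d.
Proof.
have [k kE] : exists k, k = m - j by exists (m - j).
elim: k j kE c => [|k IH] j kE c j0 cm cyc cj fc.
  have -> : c = [::].
    case: c cm cj {cyc fc} => //= p c /andP[/and4P[a0 b0 /eqP ab _] _] /andP[jp _]; lia.
  by exists [::]; split=> // f; rewrite !ev_nil.
pose cs := [seq p <- c | size p.2 == j].
pose d1 := map extend cs.
have csm : all (biclique m) cs.
  by rewrite all_filter; apply: sub_all cm => p pm /=; rewrite pm implybT.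
have d1m : all (biclique m.+1) d1.
  by rewrite all_map; apply: sub_all csm => p; apply: biclique_extend.
pose bd1 := flatten (map pbd d1).
have evbd f : ev f bd1 = ev (pcob (red f)) d1.
  by rewrite ev_flatten ev_map; apply: eq_ev => p; rewrite /= ev_pbd.
have evd1 f : ev (pcob (red f)) d1 =
    ev f cs (+) ev (fun p => cob (fun a => red f (a, common p.1 :: p.2)) p.1) cs.
  (* The faces that keep the point common p.1 and drop a vertex of p.2 cancel, since
     the part cs of c is a cycle in the fibre direction. *)
  have H : ev (fun p => cob (fun b => f (p.1, common p.1 :: b)) p.2) cs = false.
    rewrite ev_filter.
    have [j1|j1] := eqVneq j 1.
      rewrite -(fc j1 (fun a => f (a, [:: common a]))).
      apply: eq_ev => -[a b] /=; rewrite j1; case: b => [|y [|? ?]] //=.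
      by rewrite cob_cons cob_nil addbF.
    pose g p := (size p.2 == j.-1) && f (p.1, common p.1 :: p.2).
    rewrite -(cyc g).
    have := conj cm cj => /andP; rewrite -all_predI => cmj.
    apply: eq_ev_all cmj _ => -[a b] /andP[/and4P[/= a0 b0 _ _] jb].
    rewrite /pcob /=.
    have -> : cob (fun a' => red g (a', b)) a = false.
      rewrite -[RHS](cob0 a); apply: eq_cob => a'; rewrite /red /g /=.
      by rewrite (_ : size b == j.-1 = false) ?andbF //; lia.
    rewrite /= /cob -ev_andl; apply: eq_ev_all (size_faces b) _ => b' /= /eqP bb'.
    rewrite /red /g /= a0 /=.
    have -> : (size b' == j.-1) = (size b == j) by lia.
    case: eqP => //= sbj; last by rewrite andbF.
    by rewrite (_ : 0 < size b') //; lia.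
  rewrite ev_map -[RHS]addbF -{}H -!ev_add.
  apply: eq_ev_all csm _ => -[a b] /and4P[/= a0 b0 _ _].
  rewrite /pcob /= cob_cons /red /= a0 b0 /=.
  by rewrite addbCA addbA.
pose c' := [seq p <- c ++ bd1 | j < size p.2].
have evc' f : ev f c = ev f c' (+) ev (pcob (red f)) d1.
  rewrite ev_filter ev_cat evbd.
  have -> : ev (pcob (red (fun p => (j < size p.2) && f p))) d1
     = ev (fun p => cob (fun a => red f (a, common p.1 :: p.2)) p.1) cs.
    rewrite evd1.
    have -> : ev (fun p => (j < size p.2) && f p) cs = false.
      rewrite ev_filter -[RHS](ev0 c); apply: eq_ev => p.
      by case: eqP => // ->; rewrite ltnn.
    rewrite /cs !ev_filter; apply: eq_ev => p /=; case: eqP => //= pj.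
    by apply: eq_cob => a; rewrite /red /= pj ltnSn.
  rewrite evd1 -addbA [X in _ (+) X]addbCA addbb addbF /cs ev_filter -ev_add.
  apply: eq_ev_all cj _ => p; rewrite leq_eqVlt eq_sym.
  by case: eqP => [-> _|_ /= ->]; rewrite ?ltnn //= addbF.
have kE' : k = m - j.+1 by lia.
have [||f|||d [dm dE]] := IH j.+1 kE' c'.
- by [].
- rewrite all_filter all_cat all_flatten !all_map; apply/andP; split.
    by apply: sub_all cm => p /= ->; rewrite implybT.
  apply: sub_all csm => p /biclique_extend /biclique_pbd /=.
  by apply: sub_all => q qm; apply/implyP.
- have := evc' (pcob (red f)); rewrite cyc.
  have -> : ev (pcob (red (pcob (red f)))) d1 = false.
    rewrite -[RHS](ev0 d1); apply: eq_ev => p.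
    by rewrite -[RHS](pcob_pcob (red f) p); apply: eq_pcob => q; apply: red_pcob.
  by rewrite addbF.
- by apply: filter_all.
- by lia.
exists (d ++ d1); split; first by rewrite all_cat dm.
by move=> f; rewrite ev_cat -dE evc'.
Qed.

(** Projecting to the first sides sends a cycle to a cycle of N(G), which bounds.
After the boundary is lifted to the cells whose second side is a chosen common
neighbor, bounds_above applies. *)
Lemma bicliques_acyclic c : acyclic (@nbhd G) m.-1 -> all (biclique m) c ->
  (forall f, ev (pcob (red f)) c = false) -> (m = 2 -> ev xpredT c = false) ->
  exists d, all (biclique m.+1) d /\ forall f, ev f c = ev (pcob (red f)) d.
Proof.
move=> acy cm cyc c2.
pose cs := [seq p <- c | size p.2 == 1].
have csE (f : seq G -> bool) : ev f (map fst cs) = ev (fun p => (size p.2 == 1) && f p.1) c.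
  by rewrite ev_map ev_filter.
have [|||g [Kg gq gE]] := acy (map fst cs).
- rewrite all_map all_filter; apply: sub_all cm => p /biclique_nbhd pn /=.
  by rewrite pn implybT.
- rewrite all_map all_filter; apply: sub_all cm => p /and4P[_ _ /eqP pm _] /=.
  by apply/implyP => /eqP p1; apply/eqP; lia.
- move=> f; rewrite csE.
  (* For m = 2 the projections are single vertices, and they form a cycle of the
     augmented complex when their number is even. *)
  have [mE|mE] := eqVneq m 2.
    rewrite -[RHS](andbF (f [::])) -(c2 mE) -ev_andl.
    apply: eq_ev_all cm _ => -[a b] /and4P[/= a0 b0 /eqP ab _].
    case: a a0 ab => // x [|? ?] // _; case: b b0 => [|y [|? ?]] //=; try lia.
    by rewrite cob_cons cob_nil addbF andbT.
  pose h p := (size p.2 == 1) && f p.1.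
  rewrite -(cyc h); apply: eq_ev_all cm _ => -[a b] /and4P[/= a0 b0 /eqP ab _].
  rewrite /pcob /=.
  have -> : cob (fun b' => red h (a, b')) b = false.
    (* The two faces of a second side of size 2 have the same projection. *)
    case: b b0 ab => [|y [|y' [|y3 b]]] //= _ ab.
    - by rewrite cob_cons cob_nil /red /= andbF.
    - by rewrite !cob_cons cob_nil /red /h /= a0 /= addbF addbb.
    - rewrite -[RHS](ev0 (faces (y :: y' :: y3 :: b))).
      apply: eq_ev_all (size_faces _) _ => b' /= /eqP[sb].
      by rewrite /red /h /= sb /= !andbF.
  rewrite addbF /cob -ev_andl; apply: eq_ev_all (size_faces a) _ => a' /= /eqP aa'.
  rewrite /red /h /= b0 /=; case: eqP => b1 /=; last by rewrite andbF.
  by rewrite (_ : 0 < size a') //; lia.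
pose d1 := [seq (a, [:: common a]) | a <- g].
have d1m : all (biclique m.+1) d1.
  have := conj Kg gq => /andP; rewrite -all_predI all_map; apply: sub_all => a.
  case/andP=> /commonP na /eqP sa; apply/and4P; split=> //=.
  - by rewrite sa.
  - by rewrite sa; lia.
  - by apply: sub_all na => u; rewrite andbT adjbC.
pose bd1 := flatten (map pbd d1).
have evbd f : ev f bd1 = ev (pcob (red f)) d1.
  by rewrite ev_flatten ev_map; apply: eq_ev => p; rewrite /= ev_pbd.
have [||f|||d [dm dE]] := @bounds_above (c ++ bd1) 1.
- by [].
- rewrite all_cat cm all_flatten all_map; apply: sub_all d1m => p.
  exact: biclique_pbd.
- rewrite ev_cat cyc evbd -[RHS](ev0 d1); apply: eq_ev => p.
  by rewrite -[RHS](pcob_pcob (red f) p); apply: eq_pcob => q; apply: red_pcob.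
- rewrite all_cat; apply/andP; split.
    by apply: sub_all cm => p /and4P[].
  rewrite all_flatten all_map; apply: sub_all d1m => p /biclique_pbd /=.
  by apply: sub_all => q /and4P[].
- move=> _ f; rewrite ev_cat -csE gE evbd /d1 ev_map -ev_add -[RHS](ev0 g).
  apply: eq_ev_all gq _ => a /= /eqP sa.
  rewrite /pcob /= cob_cons cob_nil /red /= andbF !addbF /=.
  rewrite -[RHS](addbb (cob f a)) /cob; congr addb.
  apply: eq_ev_all (size_faces a) _ => a' /= /eqP aa'.
  by rewrite (_ : 0 < size a') //; lia.
exists (d ++ d1); split; first by rewrite all_cat dm.
by move=> f; rewrite ev_cat -dE ev_cat evbd -addbA addbb addbF.
Qed.
End Acyclicity.
End Bicliques.
Arguments swap {G} p.

(** * Alternating bicliques and the cup product *)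

Section SymmetricCochains.
Variable T : eqType.
Implicit Types (F : seq T -> bool) (s : seq T).

Definition symmetric F : Prop := forall s s', perm_eq s s' -> F s = F s'.

Lemma cob_rem F s : symmetric F -> cob F s = ev (fun x => F (rem x s)) s.
Proof.
elim: s F => [|x s IH] F symF; first by rewrite cob_nil ev_nil.
rewrite cob_cons ev_cons /= eqxx IH; last first.
  by move=> s1 s2 ss; apply: symF; rewrite perm_cons.
congr addb; apply: eq_big_seq => y ys /=; case: eqP => // ->.
by apply: symF; rewrite perm_sym; apply: perm_to_rem.
Qed.

Lemma cob_perm F s s' : symmetric F -> perm_eq s s' -> cob F s = cob F s'.
Proof.
move=> symF ss; rewrite !cob_rem // /ev (perm_big _ ss) /=.
apply: eq_bigr => x _; apply: symF; apply/permP => P.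
by rewrite !count_rem (perm_mem ss) (permP ss P).
Qed.

(** If s repeats an entry, then only the two faces that omit one of the two copies
have a chance to be free of repetitions, and they cancel. *)
Lemma cob_degenerate F s : symmetric F -> (forall s', ~~ uniq s' -> F s' = false) ->
  ~~ uniq s -> cob F s = false.
Proof.
move=> symF F0; elim: s => //= x s IH in F symF F0 *.
rewrite negb_and negbK cob_cons => /orP[xs|us].
  rewrite (@cob_perm _ s (x :: rem x s)) ?perm_to_rem //; last first.
    by move=> s1 s2 ss; apply: symF; rewrite perm_cons.
  rewrite cob_cons /= (symF _ _ (perm_to_rem xs)) addbA addbb /=.
  by rewrite -[RHS](cob0 (rem x s)); apply: eq_cob => s'; rewrite /= F0 //= in_cons eqxx.
rewrite F0 //= IH // => [s1 s2 ss|s' us'].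
  by apply: symF; rewrite perm_cons.
by apply: F0; rewrite /= negb_and us' orbT.
Qed.
End SymmetricCochains.

Section Alternation.

Fixpoint altb (b : bool) (w : seq bool) : bool :=
  if w is x :: w' then (x == b) && altb (~~ b) w' else true.

(** Deleting a letter of a word gives an alternating word only if the word itself
alternates and the letter is at one of its ends, or if the word has exactly one
equal pair of neighbors, whose two deletions cancel. *)
Lemma cob_altb b w : cob (altb b) w = altb b w (+) altb (~~ b) w.
Proof.
elim: w b => [|x w IH] b; first by rewrite cob_nil.
rewrite cob_cons /=.
have -> : cob (altb b \o cons x) w = (x == b) && cob (altb (~~ b)) w.
  by rewrite /cob -ev_andl.
by rewrite IH negbK; case: x; case: b; case: (altb _ w); case: (altb _ w).
Qed.

Lemma altb_neg b w : altb b (map negb w) = altb (~~ b) w.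
Proof. by elim: w b => //= x w IH b; rewrite IH; case: x; case: b. Qed.

Lemma altb_count b w : altb b w ->
  count id w = if b then uphalf (size w) else (size w)./2.
Proof.
elim: w b => [|x w IH] b /=; first by case: b.
by case/andP=> /eqP -> /IH ->; case: b => /=; rewrite ?uphalf_half; lia.
Qed.

Definition alternating (l : seq nat) : bool := altb false (map odd (sort leq l)).

Lemma alternating_sym : symmetric alternating.
Proof.
move=> s s' /(perm_sortP leq_total leq_trans anti_leq) ss.
by rewrite /alternating ss.
Qed.

Lemma altb_uniq b l : sorted leq l -> altb b (map odd l) -> uniq l.
Proof.
move=> sl al; apply: (sorted_uniq ltn_trans ltnn).
elim: l b sl al => [|x [|y l] IH] b //= /andP[xy sl] /andP[/eqP xb ayl].
have := IH _ sl ayl; rewrite /= => ->; rewrite andbT ltn_neqAle xy andbT.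
by case/andP: ayl => /eqP yb _; apply: contra_eqN xb => /eqP ->; rewrite yb; case: (b).
Qed.

Lemma alternating_uniq l : alternating l -> uniq l.
Proof.
by move/(altb_uniq (sort_sorted leq_total l)); rewrite sort_uniq.
Qed.

Lemma alternating_count l : alternating l -> count odd l = (size l)./2.
Proof.
move/altb_count; rewrite size_map size_sort count_map => <-.
by apply: permP; rewrite perm_sym perm_sort.
Qed.

Lemma subseq_faces (T : eqType) (s : seq T) : all (fun s' => subseq s' s) (faces s).
Proof.
elim: s => // x s IH; apply/andP; split; first exact: subseq_cons.
rewrite -[X in is_true X]/(all _ (map (cons x) (faces s))) all_map.
by apply: sub_all IH => s' /=; rewrite eqxx.
Qed.

Lemma cob_alternating l :
  cob alternating l = alternating l (+) altb true (map odd (sort leq l)).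
Proof.
have sl := sort_sorted leq_total l.
rewrite (@cob_perm _ _ l (sort leq l)); first last.
- by rewrite perm_sym perm_sort.
- exact: alternating_sym.
transitivity (cob (altb false \o map odd) (sort leq l)).
  apply: eq_ev_all (subseq_faces _) _ => s' /subseq_sorted.
  move=> /(_ _ leq_trans sl) s's; congr altb; congr map.
  exact: sorted_sort leq_trans _ s's.
by rewrite -cob_map cob_altb.
Qed.
End Alternation.

Lemma cob_cat T (f : seq T -> bool) s1 s2 :
  cob f (s1 ++ s2) = cob (fun s => f (s ++ s2)) s1 (+) cob (fun s => f (s1 ++ s)) s2.
Proof.
elim: s1 f => [|x s1 IH] f /=; first by rewrite cob_nil.
by rewrite !cob_cons IH addbA.
Qed.

Lemma ev_fibers A (K : eqType) (k : A -> K) (f : A -> bool) z :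
  (forall X, ev (fun p => (k p == X) && f p) z = false) -> ev f z = false.
Proof.
have [n nE] : exists n, n >= size z by exists (size z).
elim: n z nE => [|n IH] [|p z] //= nE fib; rewrite ?ev_nil //.
(* Split off the fibre of the first cell. *)
pose z' := filter (fun q => k q != k p) (p :: z).
have -> : ev f (p :: z) = ev f z'.
  rewrite -[RHS]addFb -(fib (k p)) ev_filter -ev_add; apply: eq_ev => q.
  by case: (k q == k p); rewrite //= addbF.
apply: IH => [|X].
  by rewrite /z' /= eqxx size_filter; apply: leq_trans (count_size _ _) _.
rewrite ev_filter; have [->|Xp] := eqVneq X (k p).
  by rewrite -[RHS](ev0 (p :: z)); apply: eq_ev => q; case: (k q == k p).
rewrite -(fib X); apply: eq_ev => q.
by have [->|_] := eqVneq (k q) X; rewrite ?Xp ?andbF.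
Qed.

Section Fan.
Variables (G : graph) (c : G -> nat).
Hypothesis c_proper : proper_coloring c.
Local Notation pair := (seq G * seq G)%type.
Implicit Types (p : pair) (a b : seq G) (A B : seq nat).

(** The colors of the two sides, as even and as odd numbers: sorting these numbers
sorts by color, and the parity tells the side. *)
Definition signed A B : seq nat := map double A ++ map (succn \o double) B.

(** The colors of p alternate between the two sides, the least one being on the
first side. *)
Definition fan p : bool := alternating (signed (map c p.1) (map c p.2)).

Lemma odd_signed A B : count odd (signed A B) = size B.
Proof.
rewrite count_cat !count_map (eq_count (a2 := pred0)) => [|v]; last by rewrite /= odd_double.
rewrite count_pred0 (eq_count (a2 := predT)) ?count_predT // => v.
by rewrite /= odd_double.
Qed.

Lemma size_signed A B : size (signed A B) = size A + size B.
Proof. by rewrite size_cat !size_map. Qed.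

Lemma alternating_signed A B : alternating (signed A B) ->
  [/\ size B = (size A + size B)./2, uniq A & uniq B].
Proof.
move=> alt; have := alternating_count alt; rewrite odd_signed size_signed => sB.
have := alternating_uniq alt; rewrite cat_uniq => /and3P[/map_uniq uA _ /map_uniq uB].
by [].
Qed.

Lemma fan_size m p : biclique m p -> fan p ->
  size p.1 = uphalf m /\ size p.2 = m./2.
Proof.
case/and4P=> _ _ /eqP pm _ /alternating_signed[]; rewrite !size_map pm => sB _ _.
by have := odd_double_half m; rewrite uphalf_half; lia.
Qed.

(** Exchanges 2x and 2x + 1, that is, the two sides. *)
Definition flip n := if odd n then n.-1 else n.+1.

(** As the sides have no color in common, flip preserves the order. *)
Lemma signed_flip A B : (forall x y, x \in A -> y \in B -> x <> y) ->
  alternating (signed B A) = altb true (map odd (sort leq (signed A B))).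
Proof.
move=> AB.
have inA n : n \in map double A -> n./2 \in A /\ ~~ odd n.
  by case/mapP=> x xA ->; rewrite doubleK odd_double.
have inB n : n \in map (succn \o double) B -> n./2 \in B /\ odd n.
  by case/mapP=> x xB -> /=; rewrite uphalf_double odd_double.
have mono : {in signed A B &, {homo flip : x y / x <= y}}.
  move=> x y; rewrite !mem_cat /flip => /orP[/inA|/inB] [xS ox] /orP[/inA|/inB] [yS oy] xy.
  - rewrite (negPf ox) (negPf oy); lia.
  - by have := AB _ _ xS yS; rewrite (negPf ox) oy; lia.
  - rewrite ox (negPf oy); lia.
  - rewrite ox oy; lia.
have pe : perm_eq (signed B A) (map flip (signed A B)).
  rewrite map_cat perm_catC -!map_comp; apply: perm_cat.
    by rewrite (eq_map (g := succn \o double)) // => x; rewrite /= /flip odd_double.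
  by rewrite (eq_map (g := double)) // => x; rewrite /= /flip /= odd_double.
rewrite /alternating -(altb_neg false).
have -> : sort leq (signed B A) = map flip (sort leq (signed A B)).
  apply: (sorted_eq leq_trans anti_leq); first exact: sort_sorted leq_total _.
    have := sort_sorted leq_total (signed A B).
    rewrite !(sorted_pairwise leq_trans) pairwise_map.
    apply: (sub_in_pairwise (P := mem (signed A B))); first exact: mono.
    by apply/allP => x; rewrite mem_sort.
  rewrite perm_sort (perm_trans pe) // perm_map // perm_sym perm_sort.
  exact: perm_refl.
rewrite -!map_comp; congr altb; apply: eq_map => n /=; rewrite /flip.
by case: n => //= n; case on: (odd n); rewrite /= on.
Qed.

Lemma biclique_proper m p : biclique m p ->
  forall x y, x \in map c p.1 -> y \in map c p.2 -> x <> y.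
Proof.
case/and4P=> _ _ _ ab x y xa yb.
have : all (fun x => all (fun y => x != y) (map c p.2)) (map c p.1).
  rewrite all_map; apply: sub_all ab => u /=; rewrite all_map.
  by apply: sub_all => v /asboolP uv; apply/eqP; apply: c_proper.
by move=> /allP/(_ x xa)/allP/(_ y yb)/eqP.
Qed.

(** The identity behind the theorem of Ky Fan: a cell has an odd number of
alternating facets that start on the first side exactly if it is itself
alternating, starting on either side. *)
Lemma pcob_fan m p : 2 < m -> biclique m p -> pcob (red fan) p = fan p (+) fan (swap p).
Proof.
move=> m2 pm; rewrite {3}/fan /= (signed_flip (biclique_proper pm)) /fan.
rewrite -cob_alternating /signed cob_cat /pcob !cob_map.
case/and4P: pm => a0 b0 /eqP pm _; congr addb; apply: eq_ev_all (size_faces _) _ => l /= /eqP ls.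
- rewrite /red /= b0 /= /fan /signed /=; case: (posnP (size l)) => //= l0.
  symmetry; apply/negP => /(alternating_signed (A := map c l)) [+ _ _].
  by rewrite !size_map l0; lia.
- rewrite /red /= a0 /= /fan /signed /=; case: (posnP (size l)) => //= l0.
  symmetry; apply/negP => /(alternating_signed (B := map c l)) [+ _ _].
  by rewrite !size_map l0; lia.
Qed.

Lemma fan_edge u v : adj u v ->
  fan ([:: u], [:: v]) (+) fan ([:: v], [:: u]) = true.
Proof.
move=> uv; have pm : biclique 2 ([:: u], [:: v]).
  by apply/and4P; split=> //=; rewrite !andbT; apply/asboolP.
have := signed_flip (biclique_proper pm).
rewrite -[fan (_, [:: u])]/(alternating (signed [:: c v] [:: c u])) /= => ->.
rewrite -cob_alternating !cob_cons cob_nil /alternating /= !odd_double.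
by [].
Qed.

Section Chain.
Variables (x0 : G) (s : nat).
Hypothesis acyG : forall q, q <= s -> acyclic (@nbhd G) q.

Lemma exists_edge : exists u v : G, adj u v.
Proof.
have [||f|d [nd d1 dE]] := acyG (leq0n s) (c := [:: [::]]) => //=.
- by rewrite andbT; apply/asboolP; exists x0.
- by rewrite ev_cons ev_nil cob_nil.
have := dE xpredT; rewrite ev_cons ev_nil /= => /esym/(ev_has (P := [predI @nbhd G & (fun s => size s == 1)])).
case; first by rewrite all_predI nd.
move=> [|u [|? ?]] /andP[//= /asboolP[v]] /= /andP[/asboolP vu _] _ _.
by exists v, u.
Qed.

(** The cycle z is h + swap h, where h is a hemisphere of dimension n.  It
bounds some d, which is a hemisphere in dimension n + 1, and by pcob_fan the
parity of the number of alternating cells is the same for z and for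
d + swap d. *)
Lemma fan_chain n : n <= s -> exists z : seq pair,
  [/\ all (biclique n.+2) z, forall f, ev (pcob (red f)) z = false & ev fan z].
Proof.
suff : n <= s -> exists h : seq pair, [/\ all (biclique n.+2) h,
    forall f, ev (pcob (red f)) (h ++ map swap h) = false & ev fan (h ++ map swap h)].
  move=> H /H [h [hm hc hf]]; exists (h ++ map swap h); split=> //.
  by rewrite all_cat hm all_map; apply: sub_all hm => p; rewrite /= biclique_swap.
elim: n => [|n IH] ns.
  have [u [v uv]] := exists_edge; exists [:: ([:: u], [:: v])]; split=> //=.
  - by rewrite andbT; apply/and4P; split=> //=; rewrite !andbT; apply/asboolP.
  - move=> f; rewrite !ev_cons ev_nil /pcob /= !cob_cons !cob_nil.
    by rewrite /red.
  - by rewrite !ev_cons ev_nil addbF fan_edge.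
have [h [hm hc hf]] := IH (ltnW ns).
have [||||d [dm dE]] := @bicliques_acyclic G x0 n.+2 isT (h ++ map swap h).
- exact: acyG.
- by rewrite all_cat hm all_map; apply: sub_all hm => p; rewrite /= biclique_swap.
- exact: hc.
- by move=> _; rewrite ev_cat ev_map addbb.
exists d; split=> //.
- move=> f; rewrite ev_cat ev_map -dE.
  transitivity (ev f (h ++ map swap h) (+) ev (pcob (red (f \o swap))) d).
    congr addb; apply: eq_ev => p /=; rewrite -pcob_swap; apply: eq_pcob => q /=.
    by rewrite red_swap.
  rewrite -dE !ev_cat !ev_map.
  rewrite [X in _ (+) (_ (+) X)](@eq_ev _ _ f) => [|[a b]] //.
  by rewrite [in X in _ (+) X]addbC addbb.
- suff -> : ev fan (d ++ map swap d) = ev fan (h ++ map swap h) by [].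
  rewrite dE ev_cat ev_map -ev_add; symmetry.
  by apply: eq_ev_all dm _ => p; apply: pcob_fan.
Qed.

(** The number of alternating cells of z is odd.  In the odd case one such cell
suffices; in the even case the cells are grouped by the set X of the colors of
their first side, and each group is shown to be even. *)
Theorem many_colors : 0 < s -> exists (v : G) b,
  [/\ all (adjb v) b, uniq (map c b) & size b = (s.+2)./2.+1].
Proof.
move=> s0; set r := (s.+2)./2; apply: contrapT => H.
have few b : nbhd b -> size b = r.+1 -> ~~ uniq (map c b).
  by move=> /asboolP[v vb] br; apply/negP => ub; apply: H; exists v, b.
have [z [zm zc zf]] := fan_chain (leqnn s).
have fanP p : biclique s.+2 p -> fan p ->
    [/\ size p.1 = r, size p.2 = r & uniq (map c p.1)].
  move=> pm fp; have [p1 p2] := fan_size pm fp.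
  have [_ up _] := alternating_signed fp.
  split=> //; rewrite -?p2 // p1 uphalf_half -/r.
  case so: (odd s.+2) => //; have := few p.1 (biclique_nbhd pm).
  by rewrite p1 uphalf_half so => /(_ erefl); rewrite up.
suff : ev fan z = false by rewrite zf.
apply: (ev_fibers (k := fun p => sort leq (map c p.1))) => X.
have [e|[p pm]] : (forall p, biclique s.+2 p -> (sort leq (map c p.1) == X) && fan p = false) \/
   exists2 p, biclique s.+2 p & (sort leq (map c p.1) == X) && fan p.
  apply: contrapT => /not_orP[]; move=> h1 h2; apply: h1 => p pm.
  by apply/negP => h; apply: h2; exists p.
  by rewrite -[RHS](ev0 z); apply: eq_ev_all zm e.
case/andP=> /eqP pX /(fanP p pm) [p1 p2 up].
have Xr : size X = r by rewrite -pX size_sort size_map.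
have uX : uniq X by rewrite -pX sort_uniq.
have sr : s.+2 = r + r by case/and4P: pm => _ _ /eqP <- _; rewrite p1 p2.
(* On the cells with p.1 colored by X, fan is the product of U and V. *)
pose U l := sort leq l == X; pose V l := alternating (signed X l).
have Usize l : U l -> size l = r by move=> /eqP lX; rewrite -Xr -lX size_sort.
have symU : symmetric U.
  by move=> l l' /(perm_sortP leq_total leq_trans anti_leq) ll; rewrite /U ll.
have symV : symmetric V.
  by move=> l l' ll; apply: alternating_sym; rewrite perm_cat2l perm_map.
have U0 l : ~~ uniq l -> U l = false.
  by move=> ul; apply/eqP => lX; rewrite -lX sort_uniq (negPf ul) in uX.
have V0 l : ~~ uniq l -> V l = false.
  by move=> ul; apply/negP => /alternating_signed[_ _]; rewrite (negPf ul).
(* The cap product of z with the cocycle U. *)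
pose y := [seq q.2 | q <- z & U (map c q.1)].
have evy (f : seq G -> bool) : ev f y = ev (fun q => U (map c q.1) && f q.2) z.
  by rewrite ev_map ev_filter.
have rs : r <= s by lia.
have [||f|g [gn gr gE]] := acyG rs (c := y).
- rewrite all_map all_filter; apply: sub_all zm => q qm /=.
  apply/implyP => _; have : biclique s.+2 (swap q) by rewrite biclique_swap.
  exact: biclique_nbhd.
- rewrite all_map all_filter; apply: sub_all zm => q /and4P[_ _ /eqP qm _] /=.
  apply/implyP => /Usize; rewrite size_map => q1.
  by apply/eqP; lia.
- rewrite evy -(zc (fun q => U (map c q.1) && f q.2)).
  apply: eq_ev_all zm _ => -[a b] abm; have [/= a0 b0 /eqP ab _] := and4P abm.
  rewrite /pcob /=.
  (* U vanishes on the boundary of a: a tuple of r + 1 vertices with a common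
     neighbor repeats a color. *)
  have -> : cob (fun a' => red (fun q => U (map c q.1) && f q.2) (a', b)) a = false.
    transitivity (f b && cob (U \o map c) a).
      rewrite /cob -ev_andl; apply: eq_ev => a'; rewrite /red /= b0 /= andbCA andbA andbC.
      congr andb; rewrite /=; case Ua: (U _); rewrite ?andbF //=.
      by have := Usize _ Ua; rewrite size_map => ->; lia.
    rewrite -cob_map; have [ar|ar] := eqVneq (size a) r.+1.
      by rewrite cob_degenerate ?andbF //; apply: few (biclique_nbhd abm) ar.
    rewrite cob_map [X in _ && X](_ : _ = false) ?andbF //.
    rewrite -[RHS](ev0 (faces a)); apply: eq_ev_all (size_faces a) _ => a' /= /eqP aa'.
    apply/negP => /Usize; rewrite size_map => a'r.
    by move: ar; rewrite -aa' a'r eqxx.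
  rewrite /= /cob -ev_andl; apply: eq_ev_all (size_faces b) _ => b' /= /eqP bb'.
  rewrite /red /= a0 /=; case Ua: (U _); rewrite ?andbF //.
  have := Usize _ Ua; rewrite size_map => ar.
  by rewrite (_ : 0 < size b') //; lia.
transitivity (ev (V \o map c) y).
  rewrite evy; apply: eq_ev => q /=; rewrite -/(U (map c q.1)).
  case UX: (U _) => //=; apply: alternating_sym; rewrite perm_cat2r perm_map //.
  by rewrite -(eqP UX) perm_sym perm_sort.
rewrite gE -[RHS](ev0 g); have := conj gn gr => /andP; rewrite -all_predI => gnr.
apply: eq_ev_all gnr _ => b /andP[bn /eqP br].
by rewrite -cob_map cob_degenerate //; apply: few.
Qed.
End Chain.
End Fan.

(** * Local chromatic number and finite colorings *)

(** The default value 0 is never taken on a nonempty set. *)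
Lemma min_natP (P : set nat) : (exists n, P n) ->
  P (min_nat P) /\ forall n, P n -> min_nat P <= n.
Proof.
move=> exP; rewrite /min_nat.
have exP' : exists n, `[< P n >] by have [n Pn] := exP; exists n; apply/asboolP.
suff /xgetPex : exists m, (P m /\ forall n, P n -> m <= n) by [].
exists (ex_minn exP'); case: ex_minnP => m /asboolP Pm min; split=> // n Pn.
by apply: min; apply/asboolP.
Qed.

Section NeighborColors.
Local Open Scope classical_set_scope.

Lemma card_uniq_colors (C : Type) (S : set C) (T : Type) (c : T -> C)
    (c' : T -> nat) m (b : seq T) :
  (S #<= `I_m)%card -> (forall u v, c u = c v -> c' u = c' v) ->
  all (fun u => `[< S (c u) >]) b -> uniq (map c' b) -> size b <= m.
Proof.
move=> /pcard_leP[f] cc' bS ub.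
have fm u : S (c u) -> f (c u) < m by move=> Su; exact: (@funS _ _ _ _ f _ Su).
suff uf : uniq (map (f \o c) b).
  have := uniq_leq_size uf (s2 := iota 0 m); rewrite size_map size_iota; apply => i.
  rewrite mem_iota add0n; elim: b bS {ub uf} => //= u b IH /andP[/asboolP Su bS].
  by rewrite in_cons => /orP[/eqP ->|/(IH bS) //]; apply: fm.
elim: b bS ub => //= u b IH /andP[/asboolP Su bS] /andP[ub /(IH bS) ->].
rewrite andbT; apply: contra ub; elim: b bS {IH} => //= v b IH /andP[/asboolP Sv bS].
rewrite !in_cons => /orP[/eqP uv|/(IH bS) ->]; last by rewrite orbT.
apply/orP; left; apply/eqP/cc'; apply: inj uv; exact/mem_set.
Qed.

Section LocalChromatic.
Variable G : graph.

(** The color of v itself is missing from its neighborhood. *)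
Lemma neighbor_colors_lt N (c : G -> 'I_N) v m : proper_coloring c ->
  (c @` neighbors v #= `I_m)%card -> m < N.
Proof.
move=> cp cm; pose f i := if unlift (c v) i is Some j then val j else 0.
have fE i : (c @` neighbors v) i -> exists2 j, i = lift (c v) j & f i = val j.
  move=> [w vw <-]; have /unlift_some[j wj fj] : c v != c w by apply/eqP/cp.
  by exists j => //; rewrite /f fj.
have finj : {in c @` neighbors v &, injective f}.
  move=> i i' /set_mem/fE[j -> ->] /set_mem/fE[j' -> ->] jj'.
  by congr lift; apply: val_inj.
have N0 : 0 < N by apply: leq_ltn_trans (ltn_ord (c v)).
suff : m <= N.-1 by lia.
rewrite -card_le_II -(card_le_eql cm) -(card_le_eql (inj_card_eq finj)).
by apply: subset_card_le => _ [i /fE[j _ ->] <-]; apply: ltn_ord.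
Qed.

Lemma finite_coloring_max N (c : G -> 'I_N) : inhabited G -> proper_coloring c ->
  exists2 m, max_neighbor_colors c m & m < N.
Proof.
move=> [x0] cp.
have nv v : {m | (c @` neighbors v #= `I_m)%card}.
  by apply: cid; apply/finite_setP; apply: finite_finset.
have nvN v : sval (nv v) < N by apply: neighbor_colors_lt cp (svalP (nv v)).
pose P m := `[< exists v, sval (nv v) = m >].
have exP : exists m, P m by exists (sval (nv x0)); apply/asboolP; exists x0.
have ubP m : P m -> m <= N by move=> /asboolP[v <-]; apply: ltnW.
case: (ex_maxnP exP ubP) => m /asboolP[v vm] mmax.
exists m; last by rewrite -vm.
split; last by exists v; have := svalP (nv v); rewrite vm.
move=> w; rewrite (card_le_eql (svalP (nv w))) card_le_II.
by apply: mmax; apply/asboolP; exists w.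
Qed.

Lemma local_chromatic_bounds N k : inhabited G ->
  (exists c : G -> 'I_N, proper_coloring c) ->
  (forall (C : Type) (c : G -> C) m, proper_coloring c ->
     (forall v, (c @` neighbors v #<= `I_m)%card) -> k <= m) ->
  k < local_chromatic_number G <= N.
Proof.
move=> x0 [c cp] lb; have [m cm mN] := finite_coloring_max x0 cp.
rewrite /local_chromatic_number; set P := (X in min_nat X).
have Pm : P (m + 1) by exists 'I_N, c, m.
have [PP min] : P (min_nat P) /\ forall n, P n -> min_nat P <= n.
  by apply: min_natP; exists (m + 1).
have := min _ Pm; case: PP => C [c1 [m1 [c1p [le _] ->]]].
rewrite !addn1 => h; apply/andP; split; last exact: leq_trans h mN.
exact: lb c1p le.
Qed.
End LocalChromatic.

End NeighborColors.

Definition graph_hom (G H : graph) (f : G -> H) : Prop := forall u v, adj u v -> adj (f u) (f v).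

(** Countability lets colors of an arbitrary type be replaced by natural numbers. *)
Lemma iterated_countable rs : exists f : iterated_Mycielskian rs -> nat, injective f.
Proof.
elim/last_ind: rs => [|rs r [f finj]]; first by exists val; apply: val_inj.
rewrite iterated_rcons.
exists (fun x : option ('I_r * iterated_Mycielskian rs) =>
  if x is Some (i, v) then (pickle (val i, f v)).+1 else 0).
move=> [[i v]|] [[j w]|] //= [] /(pcan_inj pickleK) [ij vw].
by congr (Some (_, _)); [apply: val_inj | apply: finj].
Qed.

Lemma Mycielskian_many_colors rs (G : graph) (f : iterated_Mycielskian rs -> G)
    (C : Type) (c : G -> C) m :
  0 < size rs -> all (fun r => 1 <= r) rs -> graph_hom f -> proper_coloring c ->
  (forall v, (c @` neighbors v #<= `I_m)%card)%classic -> (size rs).+2./2.+1 <= m.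
Proof.
move=> s0 rs1 fhom cp cm; have [g ginj] := iterated_countable rs.
have [x0] := iterated_point rs.
pose cf := c \o f.
pose rep k : iterated_Mycielskian rs :=
  if pselect (exists v, cf v = k) is left h then projT1 (cid h) else x0.
have repE v : cf (rep (cf v)) = cf v.
  rewrite /rep; case: pselect => [h|[]]; last by exists v.
  by case: (cid h).
pose c' v := g (rep (cf v)).
have c'p : proper_coloring c'.
  move=> u v uv /ginj h; apply: (cp _ _ (fhom _ _ uv)).
  by have := repE u; rewrite h repE => /esym.
have [v [b [vb ub bs]]] := many_colors c'p x0 (fun q => acyclic_iterated rs1) s0.
rewrite -bs.
apply: (@card_uniq_colors _ _ _ cf c' m b (cm (f v))) => //.
  by move=> u w; rewrite /c' => ->.
apply: sub_all vb => u /asboolP vu; apply/asboolP.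
by exists (f u) => //; apply: fhom.
Qed.

(** All rows repeat the coloring of the base graph, and z gets a new color. *)
Lemma iterated_coloring rs :
  exists c : iterated_Mycielskian rs -> 'I_(size rs).+2, proper_coloring c.
Proof.
elim/last_ind: rs => [|rs r [c cp]]; first by exists id.
rewrite iterated_rcons size_rcons.
exists (fun x => if x is Some (_, v) then lift ord_max (c v) else ord_max).
move=> [[i v]|] [[j w]|] //=.
- by case=> vw _ /lift_inj; apply: cp.
- by move=> _ /eqP; rewrite eq_sym (negPf (neq_lift _ _)).
- by move=> _ /eqP; rewrite (negPf (neq_lift _ _)).
Qed.

(** The color is the least element, cut off at n - 2k + 1; the elements from there
on are too few for two disjoint k-sets. *)
Lemma Kneser_coloring n k : 1 <= k -> 2 * k <= n ->
  exists c : Kneser n k -> 'I_(n - 2 * k + 2), proper_coloring c.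
Proof.
move=> k1 kn.
have ne (A : ksubset n k) : {i | i \in val A}.
  by apply: cid; apply/set0Pn; rewrite -card_gt0 (eqP (valP A)).
pose mn (A : ksubset n k) := [arg min_(i < sval (ne A) in val A) (i : nat)].
have mnP A : mn A \in val A /\ forall j, j \in val A -> mn A <= j.
  by rewrite /mn; case: arg_minnP => [|i iA imin]; [exact: (svalP (ne A)) | split].
have lt2 A : minn (mn A) (n - 2 * k + 1) < n - 2 * k + 2 by lia.
exists (fun A => Ordinal (lt2 A)) => A B [_ dAB] /(congr1 val) /= e.
have [mA minA] := mnP A; have [mB minB] := mnP B.
have mAB : mn A <> mn B.
  by move=> AB; have := disjointFr dAB mA; rewrite AB mB.
have [hA hB] : n - 2 * k + 1 <= mn A /\ n - 2 * k + 1 <= mn B.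
  have : mn A <> mn B :> nat by move=> /val_inj.
  by move: e; lia.
have sub : val A :|: val B \subset [set i : 'I_n | n - 2 * k + 1 <= i]%SET.
  by apply/fintype.subsetP => i; rewrite !inE => /orP[/minA|/minB]; apply: leq_trans.
have := subset_leq_card sub; rewrite cardsU (eqP (valP A)) (eqP (valP B)).
have -> : val A :&: val B = finset.set0 by apply/disjoint_setI0.
rewrite cards0 subn0.
have -> : #|[set i : 'I_n | n - 2 * k + 1 <= i]%SET| = n - (n - 2 * k + 1).
  rewrite -sum1_card (eq_bigl (fun i : 'I_n => n - 2 * k + 1 <= i)) => [|i]; last by rewrite inE.
  rewrite -(big_mkord (fun i => n - 2 * k + 1 <= i) (fun=> 1)).
  rewrite (big_cat_nat (n := n - 2 * k + 1)) /=; [|lia|lia].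
  rewrite big_nat_cond big_pred0 ?add0n => [|i]; last lia.
  rewrite big_nat_cond (eq_bigl (fun i => (n - 2 * k + 1 <= i < n) && true)) => [|i]; last by lia.
  by rewrite -big_nat_cond sum_nat_const_nat muln1.
lia.
Qed.

Lemma Schrijver_coloring n k : 1 <= k -> 2 * k <= n ->
  exists c : Schrijver n k -> 'I_(n - 2 * k + 2), proper_coloring c.
Proof.
move=> k1 kn; have [c cp] := Kneser_coloring k1 kn.
by exists (fun A : Schrijver n k => c (val A)) => A B AB; apply: cp.
Qed.

Lemma chromatic_coloring (G : graph) N : chromatic_number G = N -> 0 < N ->
  exists c : G -> 'I_N, proper_coloring c.
Proof.
by rewrite /chromatic_number /min_nat => <-; case: xgetP => [m _ []|].
Qed.

(** * Mycielskians on spheres *)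

Section SphereMap.
Local Open Scope ring_scope.
Variable R : realType.

(** Adjacent vertices go to unit vectors of R^d that are antipodal up to eps. *)
Definition sphere_hom d (eps : R) (G : graph) (f : G -> nat -> R) : Prop :=
  (forall v, \sum_(l < d) f v l ^+ 2 = 1) /\
  (forall u v, adj u v -> \sum_(l < d) (f u l + f v l) ^+ 2 <= eps).

Lemma sqrt_diff (x y : R) : 0 <= x -> 0 <= y ->
  (Num.sqrt x - Num.sqrt y) ^+ 2 <= `|x - y|.
Proof.
move=> x0 y0; rewrite -{2}(sqr_sqrtr x0) -{2}(sqr_sqrtr y0) subr_sqr.
have := sqrtr_ge0 x; have := sqrtr_ge0 y.
move: (Num.sqrt x) (Num.sqrt y) => a b b0 a0.
rewrite normrM -real_normK ?num_real // expr2 ler_wpM2l // (ger0_norm (_ : 0 <= a + b)); last exact: addr_ge0.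
rewrite ler_norml; lra.
Qed.

(** The identity a x + b y = a (x + y) - (a - b) y, with y a unit vector. *)
Lemma combination_bound d (a b : R) (x y : nat -> R) :
  `|a| <= 1 -> \sum_(l < d) y l ^+ 2 = 1 ->
  \sum_(l < d) (a * x l + b * y l) ^+ 2
    <= 2 * \sum_(l < d) (x l + y l) ^+ 2 + 2 * (a - b) ^+ 2.
Proof.
move=> a1 y1.
rewrite -[2 * (a - b) ^+ 2]mulr1 -y1 !mulr_sumr -big_split /=; apply: ler_sum => l _.
have a2 : a ^+ 2 <= 1 by rewrite -real_normK ?num_real // expr_le1.
have := sqr_ge0 (x l + y l); have := sqr_ge0 (a * (x l + y l) - (b - a) * y l).
nra.
Qed.

Section Step.
Variables (G : graph) (f : G -> nat -> R) (d : nat) (eps : R) (r : nat).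
Hypotheses (fP : sphere_hom d eps f) (r0 : (0 < r)%N).

Definition height (i : nat) : R := i%:R / r%:R.
Definition radius (i : nat) : R := Num.sqrt (1 - height i ^+ 2).

(** Row i is a scaled copy of f at height i/r in the north or the south according to
the parity of i; the vertex z is the pole on the side opposite to row r - 1. *)
Definition suspend (x : Mycielskian r G) (l : nat) : R :=
  match x with
  | Some (i, v) => if (l < d)%N then radius i * f v l else (-1) ^+ i * height i
  | None => if (l < d)%N then 0 else (-1) ^+ r
  end.

Let r0R : 0 < r%:R :> R. Proof. by rewrite ltr0n. Qed.

Lemma height_ge0 i : 0 <= height i.
Proof. by rewrite divr_ge0. Qed.

Lemma height_le1 i : (i <= r)%N -> height i <= 1.
Proof. by move=> ir; rewrite ler_pdivrMr // mul1r ler_nat. Qed.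

Lemma heightS i : height i.+1 = height i + r%:R^-1.
Proof. by rewrite /height -natr1 mulrDl div1r. Qed.

Lemma radius_sqr i : (i <= r)%N -> radius i ^+ 2 = 1 - height i ^+ 2.
Proof.
move=> ir; rewrite sqr_sqrtr //.
have := height_ge0 i; have := height_le1 ir; nra.
Qed.

Lemma radius_le1 i : `|radius i| <= 1.
Proof.
rewrite ger0_norm ?sqrtr_ge0 // -[leRHS]sqrtr1 ler_wsqrtr //.
have := sqr_ge0 (height i); lra.
Qed.

Lemma signM_sqr i (y : R) : ((-1) ^+ i * y) ^+ 2 = y ^+ 2.
Proof. by rewrite exprMn sqrr_sign mul1r. Qed.

(** The heights of consecutive rows differ by 1/r, and the squares of their radii by
at most 2/r. *)
Lemma suspend_adjacent (i j : 'I_r) v w : adj v w -> j = i.+1 :> nat ->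
  \sum_(l < d.+1) (suspend (Some (i, v)) l + suspend (Some (j, w)) l) ^+ 2
    <= 2 * eps + 5 / r%:R.
Proof.
move=> vw ji; case: fP => f1 fe; rewrite big_ord_recr /= ltnn.
under eq_bigr => l _ do rewrite ltn_ord.
have := combination_bound (radius j) (f v) (radius_le1 i) (f1 w).
have /= := fe _ _ vw; rewrite ji.
have i1r : (i.+1 <= r)%N by have := ltn_ord j; rewrite ji => /ltnW.
have h1 := height_le1 i1r; have h2 := height_ge0 i.
have ri : 0 < r%:R^-1 :> R by rewrite invr_gt0.
have ri1 : r%:R^-1 <= 1 :> R by rewrite invf_le1 // ler1n.
have -> : (-1) ^+ i * height i + (-1) ^+ i.+1 * height i.+1
    = (-1) ^+ i * (height i - height i.+1) by rewrite exprS; ring.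
rewrite signM_sqr heightS in h1 *.
have : (radius i - radius i.+1) ^+ 2 <= 2 / r%:R.
  apply: le_trans (sqrt_diff _ _) _; rewrite ?heightS; [nra | nra |].
  by rewrite ler_norml; nra.
move: (\sum_(_ < _) _) (\sum_(_ < _) _) => S1 S2.
move: (_ - _) (height i) h1 h2 => D h h1 h2 Dle S2le S1le.
have -> : h - (h + r%:R^-1) = - r%:R^-1 by ring.
rewrite sqrrN; move: (r%:R^-1) ri ri1 Dle h1 => q q0 q1 Dle h1.
nra.
Qed.

Lemma suspend_hom : 0 <= eps -> sphere_hom d.+1 (2 * eps + 5 / r%:R) suspend.
Proof.
move=> eps0; have ri : 0 < r%:R^-1 :> R by rewrite invr_gt0.
have ri1 : r%:R^-1 <= 1 :> R by rewrite invf_le1 // ler1n.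
case: (fP) => f1 fe; split.
  move=> [[i v]|]; rewrite big_ord_recr /= ltnn.
    under eq_bigr => l _ do rewrite ltn_ord exprMn.
    rewrite -mulr_sumr f1 mulr1 signM_sqr radius_sqr ?subrK //.
    exact: ltnW.
  rewrite big1 ?add0r ?sqrr_sign // => l _; by rewrite ltn_ord expr0n.
have top (i : 'I_r) v : i = (r - 1)%N :> nat ->
   \sum_(l < d.+1) (suspend (Some (i, v)) l + suspend None l) ^+ 2 <= 2 * eps + 5 / r%:R.
  move=> ir; rewrite big_ord_recr /= ltnn.
  under eq_bigr => l _ do rewrite ltn_ord addr0 exprMn.
  rewrite -mulr_sumr f1 mulr1 radius_sqr; last by rewrite ltnW.
  have rE : r = i.+1 by lia.
  rewrite [X in _ + X ^+ 2](_ : _ = (-1) ^+ i * (height i - 1)); last first.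
    have -> : (-1) ^+ r = - (-1) ^+ i :> R by rewrite [in LHS]rE exprS mulN1r.
    by ring.
  rewrite signM_sqr.
  have -> : height i = 1 - r%:R^-1.
    have hr : height r = 1 by rewrite /height divff ?gt_eqF.
    by have := heightS i; rewrite -rE hr; lra.
  nra.
move=> [[i v]|] [[j w]|] //=.
- case=> vw [ji|ij|[i0 j0]].
  + exact: suspend_adjacent.
  + under eq_bigr => l _ do rewrite addrC.
    by apply: (suspend_adjacent (i := j) (j := i)) => //; apply: adj_sym.
  + rewrite big_ord_recr /= ltnn i0 j0.
    have h0 : height 0 = 0 by rewrite /height mul0r.
    have r1 : radius 0 = 1 by rewrite /radius h0 expr0n subr0 sqrtr1.
    under eq_bigr => l _ do rewrite ltn_ord r1 !mul1r.
    rewrite h0 mulr0 addr0 expr0n addr0.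
    have := fe _ _ vw; lra.
- exact: top.
- by move=> jr; under eq_bigr => l _ do rewrite addrC; apply: top.
Qed.
End Step.

Lemma sphere_hom_exists d (eps : R) : 0 < eps ->
  exists rs (f : iterated_Mycielskian rs -> nat -> R),
    [/\ size rs = d, all (fun r => 0 < r)%N rs & sphere_hom d.+1 eps f].
Proof.
elim: d eps => [|d IH] eps eps0.
  exists [::], (fun (v : 'I_2) _ => (-1) ^+ v); split=> //; split.
    by move=> v; rewrite big_ord1 sqrr_sign.
  move=> u v uv; rewrite big_ord1.
  have -> : (-1) ^+ u = - (-1) ^+ v :> R.
    case: u v uv => -[|[|//]] hu [] [|[|//]] hv //= uv; rewrite ?expr0 ?expr1 ?opprK //.
      by case: uv; apply: val_inj.
    by case: uv; apply: val_inj.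
  by rewrite addNr expr0n ltW.
have [|rs [f [rsd rs1 fP]]] := IH (eps / 4); first by rewrite divr_gt0.
(* Then 5 / r <= eps / 2, and the bound of suspend_hom is at most
   2 (eps / 4) + eps / 2 = eps. *)
pose r := (Num.bound (10 / eps)).+1.
exists (rcons rs r); rewrite size_rcons rsd all_rcons rs1 iterated_rcons.
exists (suspend f d.+1 (r := r)); split=> //.
have eps4 : 0 <= eps / 4 by rewrite ltW // divr_gt0.
have [h1 h2] := suspend_hom (r := r) fP (ltn0Sn _) eps4.
split=> // u v /h2 h; apply: le_trans h _.
have : 10 / eps < r%:R.
  apply: lt_le_trans (archi_boundP _) _; first by rewrite divr_ge0 // ltW.
  by rewrite ler_nat.
rewrite ltr_pdivrMr // => hr.
have r0 : 0 < r%:R :> R by rewrite ltr0n.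
have : 5 / r%:R <= eps / 2 by rewrite ler_pdivrMr //; nra.
lra.
Qed.

(** For unit vectors |x - y|^2 = 4 - |x + y|^2. *)
Lemma Borsuk_hom d (alpha : R) : alpha < 2 -> 0 < alpha ->
  exists rs (f : iterated_Mycielskian rs -> Borsuk d.+1 alpha),
    [/\ size rs = d, all (fun r => 0 < r)%N rs & graph_hom f].
Proof.
move=> a2 a0; have e0 : 0 < 4 - alpha ^+ 2 by nra.
have [rs [f [rsd rs1 [f1 fe]]]] := sphere_hom_exists d e0.
pose g v : 'rV[R]_d.+1 := \row_l f v l.
have g1 v : euclidean_norm (g v) == 1.
  rewrite /euclidean_norm; under eq_bigr => l _ do rewrite mxE.
  by rewrite f1 sqrtr1.
exists rs, (fun v => exist _ (g v) (g1 v)); split=> // u v uv.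
have dist : alpha <= euclidean_norm (g u - g v).
  rewrite /euclidean_norm -[leLHS](ger0_norm (ltW a0)) -sqrtr_sqr ler_wsqrtr //.
  have := fe _ _ uv; have := f1 u; have := f1 v.
  have -> : \sum_(l < d.+1) (g u - g v) ord0 l ^+ 2 =
     2 * \sum_(l < d.+1) f u l ^+ 2 + 2 * \sum_(l < d.+1) f v l ^+ 2
     - \sum_(l < d.+1) (f u l + f v l) ^+ 2.
    rewrite !mulr_sumr -big_split -sumrB /=; apply: eq_bigr => l _.
    by rewrite !mxE; ring.
  by move=> -> ->; lra.
split=> // -[guv]; move: dist; rewrite /= guv subrr.
rewrite /euclidean_norm big1 ?sqrtr0; last by move=> l _; rewrite mxE expr0n.
by rewrite leNgt a0.
Qed.
End SphereMap.

(** * Schrijver graphs through the Gale alternation property *)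

Section Gale.
Local Open Scope ring_scope.
Variable R : realType.
Implicit Types (x w : nat -> R) (d N L : nat) (delta eta : R).

(** On [0, N), w has L terms of absolute value at least delta with alternating
signs. *)
Definition alternates w delta N L : Prop :=
  exists (e : bool) (j : nat -> nat),
    (forall a, (a.+1 < L)%N -> (j a < j a.+1)%N) /\
    (forall a, (a < L)%N -> (j a < N)%N /\ delta <= (-1) ^+ (e + a) * w (j a)).

Lemma alternates_le w delta delta' N L :
  delta' <= delta -> alternates w delta N L -> alternates w delta' N L.
Proof.
move=> dd [e [j [jlt jP]]]; exists e, j; split=> // a /jP[jN dw]; split=> //.
exact: le_trans dw.
Qed.

(** If the sum of two consecutive terms is large in absolute value, then one of them
is large with the same sign.  Two such choices never collide, since their signs
differ. *)
Lemma alternates_sum w delta N L : 0 < delta ->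
  alternates (fun i => - (w i + w i.+1)) (2 * delta) N L ->
  alternates w delta N.+1 L.
Proof.
move=> d0 [e [j [jlt jP]]].
pose sg a : R := (-1) ^+ (~~ e + a).
have sgE a : (-1) ^+ (e + a) = - sg a :> R.
  by rewrite /sg; case: (e) => /=; rewrite ?add0n ?add1n exprS mulN1r ?opprK.
have sgS a : sg a.+1 = - sg a by rewrite /sg addnS exprS mulN1r.
pose j' a := if delta <= sg a * w (j a) then j a else (j a).+1.
have j'P a : (a < L)%N -> delta <= sg a * w (j' a).
  move=> /jP[_]; rewrite sgE /j'; case: ifP => // /negbT; rewrite -ltNge; lra.
have j'le a : (j a <= j' a <= (j a).+1)%N by rewrite /j'; case: ifP; lia.
exists (~~ e), j'; split=> a aL; last first.
  by split; [have [] := jP a aL; have := j'le a; lia | apply: j'P].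
have := jlt a aL; have := j'le a; have := j'le a.+1.
have ne : j' a <> j' a.+1.
  move=> jj; have := j'P a (ltnW aL); have := j'P _ aL; rewrite -jj sgS; lra.
lia.
Qed.

(** The polynomial with the coefficients x in the Newton basis, whose difference is
a shift of the coefficients. *)
Definition newton d x (i : nat) : R := \sum_(l < d.+1) x l * 'C(i, l)%:R.

Lemma newton_diff d x i :
  newton d.+1 x i.+1 - newton d.+1 x i = newton d (x \o succn) i.
Proof.
rewrite /newton big_ord_recl [in X in _ - X]big_ord_recl /= !bin0.
rewrite opprD addrACA subrr add0r -sumrB; apply: eq_bigr => l _.
by rewrite /bump /= add1n binS natrD; ring.
Qed.

(** A quantitative form of the lemma of Gale, by induction on the degree.  If some
coefficient other than the constant one is not too small, then the difference of
the polynomial alternates, up to the factor (-1)^i, and so does the polynomial by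
alternates_sum.  Otherwise the polynomial is almost constant, and all its N
values alternate after multiplication by (-1)^i. *)
Lemma newton_alternates d N eta : 0 < eta ->
  exists2 delta, 0 < delta &
    forall x, (exists2 l, (l <= d)%N & eta <= `|x l|) ->
      alternates (fun i => (-1) ^+ i * newton d x i) delta N (N - d).
Proof.
elim: d N eta => [|d IH] N eta eta0.
  exists eta => // x [l]; rewrite leqn0 => /eqP -> x0.
  exists (x 0 < 0), id; rewrite subn0; split=> // a aN; split=> //.
  rewrite /newton big_ord1 bin0 mulr1 exprD -mulrA [(-1) ^+ a * _]mulrA.
  rewrite -expr2 sqrr_sign mul1r.
  by move: x0; case: (ltP (x 0) 0) => x0; rewrite ?expr1 ?expr0 ?mul1r ?mulN1r;
    [rewrite ltr0_norm | rewrite ger0_norm].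
case: N => [|N].
  by exists 1 => // x _; exists false, id; split=> a; rewrite sub0n ltn0.
(* B bounds the sum of the nonconstant basis polynomials at all N + 1 points. *)
pose B : R := 1 + \sum_(i < N.+1) \sum_(l < d.+1) 'C(i, l.+1)%:R.
have B1 : 1 <= B.
  by rewrite lerDl; apply: sumr_ge0 => i _; apply: sumr_ge0.
have B0 : 0 < B by apply: lt_le_trans B1.
have e0 : 0 < eta / (2 * B) by rewrite divr_gt0 // mulr_gt0.
have [delta d0 dP] := IH N _ e0.
exists (Num.min (delta / 2) (eta / 2)); first by rewrite lt_min !divr_gt0.
move=> x xP.
have [big|small] := pselect (exists2 l, (l <= d)%N & eta / (2 * B) <= `|x l.+1|).
  apply: (@alternates_le _ (delta / 2)); first by rewrite ge_min lexx.
  rewrite subSS; apply: alternates_sum; first by rewrite divr_gt0.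
  have := dP (x \o succn) big; rewrite mulrC divfK ?pnatr_eq0 //.
  rewrite (_ : (fun i => _) = fun i => - ((-1) ^+ i * newton d.+1 x i +
     (-1) ^+ i.+1 * newton d.+1 x i.+1)) //; apply/funext => i.
  by rewrite -newton_diff exprS; ring.
have small' l : (l <= d)%N -> `|x l.+1| <= eta / (2 * B).
  by move=> ld; rewrite leNgt; apply/negP => h; apply: small; exists l; rewrite ?ltW.
have x0 : eta <= `|x 0|.
  have [[|l] ld xl] := xP; first exact: xl.
  exfalso; apply: small; exists l => //; apply: le_trans xl.
  by rewrite ler_pdivrMr ?mulr_gt0 //; nra.
apply: (@alternates_le _ (eta / 2)); first by rewrite ge_min lexx orbT.
exists (x 0 < 0), id; split=> // a aN.
have aN' : (a < N.+1)%N by apply: leq_trans aN (leq_subr _ _).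
split=> //.
rewrite exprD -mulrA [(-1) ^+ a * _]mulrA -expr2 sqrr_sign mul1r.
rewrite /newton big_ord_recl bin0 mulr1 /=.
set S := \sum_(l < _) _.
have Sle : `|S| <= eta / 2.
  apply: le_trans (ler_norm_sum _ _ _) _.
  apply: (@le_trans _ _ (\sum_(l < d.+1) eta / (2 * B) * 'C(a, l.+1)%:R)).
    apply: ler_sum => l _; rewrite normrM /bump /= add1n (ger0_norm (ler0n _ _)).
    by rewrite ler_wpM2r // small' // -ltnS.
  rewrite -mulr_sumr.
  have : \sum_(l < d.+1) 'C(a, l.+1)%:R <= B.
    rewrite /B (bigD1 (Ordinal aN')) //= addrCA lerDl addr_ge0 //.
    by apply: sumr_ge0 => i _; apply: sumr_ge0.
  move=> h; apply: le_trans (ler_wpM2l (ltW e0) h) _.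
  by rewrite invfM mulrA divfK ?gt_eqF.
move: x0 Sle; rewrite ler_norml => x0 /andP[S1 S2].
move: x0; case: (ltP (x 0) 0) => x0; rewrite ?expr1 ?expr0 ?mul1r ?mulN1r.
  by rewrite ltr0_norm //; lra.
by rewrite ger0_norm //; lra.
Qed.

(** Between two positive terms there is a negative one, so positive positions are
never consecutive.  An alternation of even length has a negative term at one end,
so the first and the last position are not both positive. *)
Lemma stable_of_alternation n k (e : bool) (j : nat -> nat) : (0 < k)%N ->
  (forall a, (a.+1 < 2 * k)%N -> (j a < j a.+1)%N) ->
  (forall a, (a < 2 * k)%N -> (j a < n)%N) ->
  exists A : ksubset n k, stable (val A) /\
    forall i, i \in val A -> exists2 b, (b < k)%N & i = j (2 * b + e)%N :> nat.
Proof.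
move=> k0 jS jn.
have jmono a b : (a < b < 2 * k)%N -> (j a < j b)%N.
  elim: b => [|b IH] /andP[ab bk] //; have := jS b bk.
  move: ab; rewrite ltnS leq_eqVlt => /orP[/eqP -> //|ab].
  by apply: ltn_trans; apply: IH; lia.
have bk (b : 'I_k) : (2 * b + e < 2 * k)%N by have := ltn_ord b; case: (e); lia.
pose h (b : 'I_k) : 'I_n := Ordinal (jn _ (bk b)).
have hmono (b b' : 'I_k) : (b < b')%N -> (h b < h b')%N.
  by move=> bb; apply: jmono; have := bk b'; case: (e); lia.
have hinj : injective h.
  move=> b b' hb; apply: val_inj; case: (ltngtP b b') => //= /hmono.
    by rewrite hb ltnn.
  by rewrite hb ltnn.
pose A := [set h b | b : 'I_k]%SET.
have Ak : #|A| == k by rewrite card_imset // card_ord.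
exists (exist _ A Ak); split=> /=; last by move=> i /imsetP[b _ ->]; exists b.
apply/forall_inP => _ /imsetP[b _ ->]; apply/forall_inP => _ /imsetP[b' _ ->].
apply/andP; split.
  apply/eqP => /= E; have [bb|bb|bb] := ltngtP b b'.
  - have l1 : (j (2 * b + e) < j (2 * b + e).+1)%N by apply: jS; have := bk b'; lia.
    have l2 : (j (2 * b + e).+1 < j (2 * b' + e))%N by apply: jmono; have := bk b'; lia.
    lia.
  - by have := hmono _ _ bb; rewrite /=; lia.
  - by move: E; rewrite bb; lia.
apply/negP => /andP[/= /eqP E0 /eqP En].
have e0 : e = false.
  case eE: e => //; have := jmono (2 * b)%N (2 * b + e)%N.
  by have := bk b; rewrite E0 eE /=; lia.
have l1 : (j (2 * b' + e) < j (2 * b' + e).+1)%N.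
  by apply: jS; rewrite e0; have := ltn_ord b'; lia.
have := jn (2 * b' + e).+1; rewrite e0 /= in l1 En *.
by have := ltn_ord b'; lia.
Qed.

(** A position i in the sets of two adjacent vertices u and v would satisfy
w u i + w v i >= 2 delta, although f u + f v is almost 0. *)
Lemma Schrijver_hom n k : (0 < k)%N -> (2 * k <= n)%N ->
  exists rs (f : iterated_Mycielskian rs -> Schrijver n k),
    [/\ size rs = (n - 2 * k)%N, all (fun r => 0 < r)%N rs & graph_hom f].
Proof.
move=> k0 kn; set d := (n - 2 * k)%N.
(* Some coordinate of a unit vector in R^(d + 1) has absolute value at least eta. *)
pose eta : R := (d.+2%:R)^-1.
have eta0 : 0 < eta by rewrite invr_gt0 ltr0n.
have [delta d0 dP] := newton_alternates d n eta0.
pose B : R := 1 + \sum_(i < n) \sum_(l < d.+1) 'C(i, l)%:R.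
have B0 : 0 < B.
  by rewrite ltr_pwDl //; apply: sumr_ge0 => i _; apply: sumr_ge0.
(* If every coordinate of f u + f v is at most theta, then its polynomial is at most
   delta at the n points. *)
pose theta : R := delta / B.
have th0 : 0 < theta by rewrite divr_gt0.
have [rs [f [rsd rs1 [f1 fe]]]] := sphere_hom_exists d (exprn_gt0 2 th0).
pose w v i : R := (-1) ^+ i * newton d (f v) i.
have fA v : exists A : ksubset n k, stable (val A) /\
    forall i, i \in val A -> delta <= w v i.
  have [|e [j [jS jP]]] := dP (f v).
    apply: contrapT => small; have := f1 v; apply/eqP; rewrite lt_eqF //.
    apply: (@le_lt_trans _ _ (\sum_(l < d.+1) eta)).
      apply: ler_sum => l _; rewrite -real_normK ?num_real //.
      have xl : `|f v l| < eta.
        by rewrite ltNge; apply/negP => h; apply: small; exists l => //; rewrite -ltnS.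
      have e1 : eta <= 1 by rewrite invf_le1 ?ltr0n // ler1n.
      have := normr_ge0 (f v l); nra.
    rewrite sumr_const card_ord -[eta *+ _]mulr_natl /eta ltr_pdivrMr ?ltr0n //.
    by rewrite mul1r ltr_nat.
  have L2 : (n - d = 2 * k)%N by rewrite /d; lia.
  rewrite L2 in jS jP.
  have [A [sA AP]] := @stable_of_alternation n k e j k0 jS (fun a h => (jP a h).1).
  exists A; split=> // i /AP[b bk iE].
  have [|_] := jP (2 * b + e)%N; first by case: (e); lia.
  have -> : (e + (2 * b + e) = 2 * (b + e))%N by lia.
  by rewrite -iE exprM sqrrN !expr1n mul1r.
pose F v := sval (cid (fA v)).
have Fst v : stable (val (F v)) by have [] := svalP (cid (fA v)).
have Fpos v i : i \in val (F v) -> delta <= w v i.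
  by have [_] := svalP (cid (fA v)); apply.
exists rs, (fun v => exist _ (F v) (Fst v)); split=> // u v uv.
have dis : [disjoint val (F u) & val (F v)].
  rewrite -setI_eq0; apply/eqP/setP => i; rewrite !inE; apply/negP.
  case/andP=> /Fpos wu /Fpos wv.
  have : w u i + w v i <= theta * B.
    rewrite /w -mulrDr; apply: le_trans (ler_norm _) _.
    rewrite normrM normrX normrN1 expr1n mul1r /newton -big_split /=.
    apply: le_trans (ler_norm_sum _ _ _) _.
    apply: (@le_trans _ _ (\sum_(l < d.+1) theta * 'C(i, l)%:R)).
      apply: ler_sum => l _; rewrite -mulrDl normrM (ger0_norm (ler0n _ _)).
      rewrite ler_wpM2r // -(@ler_pXn2r _ 2) ?nnegrE ?(ltW th0) //.
      rewrite real_normK ?num_real //; apply: le_trans (fe _ _ uv).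
      rewrite (bigD1 l) //= lerDl; apply: sumr_ge0 => ? _; exact: sqr_ge0.
    rewrite -mulr_sumr ler_wpM2l ?(ltW th0) //.
    rewrite /B (bigD1 i) //= addrCA lerDl addr_ge0 //.
    by apply: sumr_ge0 => ? _; apply: sumr_ge0.
  rewrite /theta divfK ?gt_eqF //; lra.
split=> // uvF; move: dis; rewrite -setI_eq0.
have /= -> : F u = F v by exact: uvF.
by rewrite finset.setIid -cards_eq0 (eqP (valP (F v))) eqn0Ngt k0.
Qed.
End Gale.

(** * The lower bound *)

Unset Implicit Arguments.

Theorem mainTheorem3 (R : realType) (t : nat) (G : graph) :
  3 <= t ->
  [\/ exists n k : nat,
        [/\ 1 <= k, 2 * k <= n, n - 2 * k + 2 = t & G = Kneser n k],
      exists n k : nat,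
        [/\ 1 <= k, 2 * k <= n, n - 2 * k + 2 = t & G = Schrijver n k],
      exists rs : seq nat,
        [/\ size rs = t - 2, all (fun r => 1 <= r) rs &
            G = iterated_Mycielskian rs]
    | exists alpha : R,
        [/\ (0 < alpha)%R, (alpha < 2)%R, G = Borsuk (t - 1) alpha &
            chromatic_number G = t]] ->
  [/\ t %/ 2 + 2 <= local_chromatic_number G,
      forall r : nat, t = 2 * r -> r + 2 <= local_chromatic_number G
    & t = 4 -> local_chromatic_number G = 4].
Proof.
move=> t3 family.
have [col [rs [f [rst rs1 fh]]]] :
    (exists c : G -> 'I_t, proper_coloring c) /\
    exists rs (f : iterated_Mycielskian rs -> G),
      [/\ size rs = (t - 2)%N, all (fun r => 1 <= r)%N rs & graph_hom f].
  case: family => [[n [k [k1 kn nt ->]]]|[n [k [k1 kn nt ->]]]|[rs [rst rs1 ->]]|[alpha [a0 a2 GE chi]]].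
  - rewrite -nt addnK; split; first exact: Kneser_coloring.
    have [rs [f [rsn rs1 fh]]] := Schrijver_hom R k1 kn.
    by exists rs, (fun v => val (f v)); split=> // u v /fh.
  - rewrite -nt addnK; split; first exact: Schrijver_coloring.
    exact: Schrijver_hom R _ _ k1 kn.
  - split; last by exists rs, id; split.
    by have := iterated_coloring rs; rewrite rst -addn2 subnK // ltnW.
  - split; first by apply: chromatic_coloring => //; lia.
    have tE : (t - 1)%N = (t - 2).+1 by lia.
    by rewrite GE tE; apply: Borsuk_hom.
have [x0] := iterated_point rs.
have /andP[lo hi] : (t./2.+1 < local_chromatic_number G <= t)%N.
  apply: local_chromatic_bounds (inhabits (f x0)) col _ => C c m cp cm.
  have rs0 : (0 < size rs)%N by rewrite rst subn_gt0.
  have := Mycielskian_many_colors rs0 rs1 fh cp cm.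
  by rewrite rst -addn2 subnK // ltnW.
split; first by rewrite divn2 addn2.
  by move=> r tr; move: lo; rewrite tr mul2n doubleK addn2.
by move=> t4; move: lo hi; rewrite t4 /=; lia.
Qed.
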